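(* Let $\nu$ be a charge on $\mathbb C$, let $S$ be a nonempty closed system of rays in $\mathbb C$, let $R\subset(0,+\infty)$ be an unbounded set, and let $g\colon R\to(0,+\infty)$ be a function such that $$a:=\sup_{r\in R}\frac{r}{g(r)}<1$$ and, for every $r\in R$, $$C_S^+(r,g;\nu):=\sum_{\angle_*(\alpha,\beta)} r^{\frac{\pi}{\beta-\alpha}}\int_{\angle_*(\alpha,\beta)\setminus D(g(r))}-\operatorname{Im}\frac{1}{(ze^{-i\alpha})^{\frac{\pi}{\beta-\alpha}}}\,d|\nu|(z)<+\infty,$$ where the sum is over all angles $\angle_*(\alpha,\beta)$ complementary to $S$. Then the balayage $\nu^{\rm bal}=\nu_S^{\rm bal}$ of $\nu$ onto $S$ exists, and for all $r\in R$ $$|\nu^{\rm bal}|^{\rm rad}(r)\le|\nu|^{\rm rad}\bigl(g(r)\bigr)+\frac{2}{\pi(1-\sqrt a)^2}\,C_S^+(r,g;\nu).$$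
   Context: A charge on $\mathbb C$ is a countably additive function of Borel subsets of $\mathbb C$ with values in $[-\infty,+\infty]$, finite on compact sets; $|\nu|$ is its total variation. $D(r)$ is the open disc of radius $r$ centred at $0$, $\overline D(r)$ the closed one, and $\mu^{\rm rad}(r):=\mu(\overline D(r))$. A system of rays $S$ is a set of closed rays in $\mathbb C$ starting at $0$, identified with the union of these rays; it is closed if this union is closed in $\mathbb C$. The connected components of $\mathbb C\setminus S$ are the angles complementary to $S$; each is written $\angle_*(\alpha,\beta)=\{z\ne0:\ \text{some value of }\arg z\text{ lies in }(\alpha,\beta)\}$ with $\alpha<\beta\le\alpha+2\pi$. In $\angle_*(\alpha,\beta)$ the map $z\mapsto z'=(ze^{-i\alpha})^{\pi/(\beta-\alpha)}$ uses the branch of the power positive on the positive half-axis, and maps the angle conformally onto the upper half-plane. For Borel $B\subset\mathbb C$ and $z\in\mathbb C$, $\omega(z,B;\mathbb C\setminus S)$ denotes: the harmonic measure at $z$ of $B\cap\partial\angle_*(\alpha,\beta)$ for the domain $\angle_*(\alpha,\beta)$, if $z$ lies in the complementary angle $\angle_*(\alpha,\beta)$; and $\delta_z(B)$ (Dirac measure) if $z\in S$. The balayage of $\nu$ onto $S$ is $\nu_S^{\rm bal}(B):=\int_{\mathbb C}\omega(z,B;\mathbb C\setminus S)\,d\nu(z)$; it exists if this integral is finite for every bounded Borel $B$. *)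

(* Defs.v *)
From HB Require Import structures.
From mathcomp Require Import all_boot all_order all_algebra.
From mathcomp Require Import all_classical all_reals all_analysis.
From mathcomp Require Import complex.

Set Implicit Arguments.
Unset Strict Implicit.
Unset Printing Implicit Defensive.

Import Order.TTheory GRing.Theory Num.Theory.
Import numFieldNormedType.Exports.

Local Open Scope classical_set_scope.
Local Open Scope complex_scope.
Local Open Scope ring_scope.

(* The complex plane is R[i], with its metric topology and its Borel
   sigma-algebra.  The norm of R[i] is valued in R[i], hence the injections
   r%:C when it is compared with a real radius. *)
HB.instance Definition _ (R : realType) := NormedModule.copy R[i] R[i]^o.
HB.instance Definition _ (R : realType) :=
  Measurable.copy R[i] (g_sigma_algebraType (@open R[i])).

Section Plane.
Context {R : realType}.
Implicit Types (z w zeta : R[i]) (t rho : R).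

Definition cis t : R[i] := cos t +i* sin t.

Definition is_arg z t := z = `|z| * cis t.

Definition open_disc rho : set R[i] := [set z | `|z| < rho%:C].

Definition closed_disc rho : set R[i] := [set z | `|z| <= rho%:C].

Definition boundary (D : set R[i]) : set R[i] := closure D `\` D°.

(* Neighbourhoods of the point at infinity of the Riemann sphere. *)
Definition at_infinity : set_system R[i] :=
  filter_from [set: R] (fun M => [set z | M%:C < `|z|]).

End Plane.

Section Charges.
Context {R : realType}.
Local Open Scope ereal_scope.
Implicit Types (nu : set R[i] -> \bar R) (A B : set R[i]).

(* The second clause says that no sum of values of nu on disjoint sets is
   of the form oo - oo; the sums in the third one are thus meaningful. *)
Definition is_charge nu :=
  [/\ nu set0 = 0,
      (forall A B, measurable A -> measurable B -> A `&` B = set0 ->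
        nu A +? nu B),
      semi_sigma_additive nu
    & forall K, compact K -> nu K \is a fin_num].

Definition upper_variation nu A : \bar R :=
  ereal_sup [set nu B | B in [set B | measurable B /\ B `<=` A]].

Definition lower_variation nu A : \bar R := upper_variation (\- nu) A.

(* |nu|, as the sum nu^+ + nu^- of the Jordan decomposition. *)
Definition charge_abs nu A : \bar R :=
  upper_variation nu A + lower_variation nu A.

(* If both integrals are +oo the difference is -oo: the value is a finite
   number exactly when both integrals are. *)
Definition charge_integral nu (f : R[i] -> \bar R) : \bar R :=
  \int[upper_variation nu]_z f z - \int[lower_variation nu]_z f z.

(* mu^rad(r) *)
Definition radial nu (r : R) : \bar R := nu (closed_disc r).

End Charges.

Section HarmonicMeasure.
Context {R : realType}.
Local Open Scope ereal_scope.
Implicit Types (u : R[i] -> \bar R) (D B : set R[i]) (z w zeta : R[i]).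

Definition circle_mean u z (rho : R) : \bar R :=
  ((2 * pi)^-1)%:E *
  \int[lebesgue_measure]_(t in `[0%R, (2 * pi)%R]) u (z + rho%:C * cis t)%R.

(* u is subharmonic on the open set D (u may take the value -oo, and may be
   identically -oo). *)
Definition subharmonic D u :=
  [/\ (forall z, D z -> u z < +oo),
      (forall z (a : R), D z -> u z < a%:E -> \forall w \near z, u w < a%:E)
    & (forall z, D z ->
        \forall rho \near (0%R : R)^'+, u z <= circle_mean u z rho)].

(* Lower Perron class of the boundary function that is phi on the boundary
   of D in the plane and 0 at infinity: the boundary of D is taken in the
   Riemann sphere (the last condition is void if D is bounded). *)
Definition perron_family D (phi : R[i] -> R) : set (R[i] -> \bar R) :=
  [set u | [/\ subharmonic D u,
      (forall zeta, boundary D zeta ->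
        limf_esup u (within D (nbhs zeta)) <= (phi zeta)%:E)
    & limf_esup u (within D at_infinity) <= 0]].

(* Harmonic measure at z of the part of B on the boundary of D, as the Perron
   (Perron-Wiener-Brelot) solution at z of the Dirichlet problem in D with
   boundary values the indicator function of B. *)
Definition harmonic_measure D z B : \bar R :=
  ereal_sup [set u z | u in perron_family D \1_B].

End HarmonicMeasure.

Section Balayage.
Context {R : realType}.
Local Open Scope ereal_scope.
Implicit Types (S B : set R[i]) (nu : set R[i] -> \bar R) (z : R[i]).

Definition ray (t : R) : set R[i] :=
  [set z | exists2 rho : R, (0 <= rho)%R & z = (rho%:C * cis t)%R].

(* S is the union of the rays of a system of rays. *)
Definition system_of_rays S :=
  exists T : set R, S = \bigcup_(t in T) ray t.

Definition angle (al be : R) : set R[i] :=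
  [set z | z != 0%R /\ exists2 t : R, (al < t < be)%R & is_arg z t].

(* The angles complementary to S are the components of ~` S; since
   (al + 2 k pi, be + 2 k pi) gives the same angle for all integers k, the
   condition 0 <= al < 2 pi makes each of them be listed exactly once. *)
Definition complementary_angles S : set (R * R) :=
  [set ab | [/\ (0 <= ab.1 < 2 * pi)%R,
      (ab.1 < ab.2 <= ab.1 + 2 * pi)%R
    & exists2 z, (~` S) z & angle ab.1 ab.2 = connected_component (~` S) z]].

(* The value of arg z in ]0, de[ (unique if de <= 2 pi). *)
Definition arg_in (de : R) z : R :=
  xget 0%R [set t : R | (0 < t < de)%R /\ is_arg z t].

(* z |-> (z e^(-i al))^(pi / (be - al)) on angle al be; the branch of the
   power in question is w |-> |w|^p e^(i p arg w) with arg w in ]0, be - al[. *)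
Definition angle_map (al be : R) z : R[i] :=
  (let w := z * cis (- al) in
   let p := pi / (be - al) in
   (complex.Re `|w| `^ p)%:C * cis (p * arg_in (be - al) w))%R.

(* omega(z, B; ~` S) *)
Definition rays_harmonic_measure S z B : \bar R :=
  if z \in S then \d_z B
  else harmonic_measure (connected_component (~` S) z) z B.

Definition balayage nu S B : \bar R :=
  charge_integral nu (fun z => rays_harmonic_measure S z B).

Definition balayage_exists nu S :=
  forall B, measurable B -> bounded_set B -> balayage nu S B \is a fin_num.

(* C_S^+(r, g; nu), where rho stands for g(r) *)
Definition C_plus S nu (r rho : R) : \bar R :=
  \esum_(ab in complementary_angles S)
    ((r `^ (pi / (ab.2 - ab.1)))%:E *
     \int[charge_abs nu]_(z in angle ab.1 ab.2 `\` open_disc rho)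
       (- complex.Im (angle_map ab.1 ab.2 z)^-1)%:E).

End Balayage.

(* Main.v *)
(* Let p = pi / (be - al) and let w = z' be the image of z in the upper half-plane.
   The harmonic measure of the part of the boundary of the angle in the closed
   disc of radius r is that of [-t, t] with t = r^p, i.e. the angle under which
   [-t, t] is seen from w, divided by pi.  For |w| > t this angle is at most its
   tangent 2 t Im w / (|w|^2 - t^2) <= 2 t Im w / (|w| - t)^2, and for
   |z| >= g(r) one has t / |w| <= a^p <= sqrt a because p >= 1/2; this gives the
   bound 2 / (pi (1 - sqrt a)^2) r^p (- Im (1 / w)).  The harmonic measure is at
   most 1 in the disc of radius g(r), and on S it is a Dirac measure, which does
   not charge the disc of radius r when |z| > g(r) > r.  Integrating against
   nu^+ and nu^- and summing over the countably many angles bounds the total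
   variation of the balayage.

   The upper bound for the Perron solution is a maximum principle: the explicit
   kernel V has an expansion V(z + h) = V(z) + Im (c1 h + c2 h^2) + o(|h|^2), so
   that at an interior maximum of u - V + eps |.|^2 the circle means of the
   subharmonic function u would be smaller than its value at the centre. *)

Require Import Defs.
From HB Require Import structures.
From mathcomp Require Import all_boot all_order all_algebra.
From mathcomp Require Import all_classical all_reals all_analysis.
From mathcomp Require Import measurable_realfun.
From mathcomp Require Import complex ring lra.
Import Order.TTheory GRing.Theory Num.Theory.
Import numFieldNormedType.Exports.
Import ComplexField.Normc.
Local Open Scope classical_set_scope.
Local Open Scope ring_scope.
Set Implicit Arguments.
Unset Strict Implicit.

(** * Topology of the complex plane *)

(** Harmonic measure is only bounded from above, never computed, and its measurability in z is not
    established: integrals are compared as suprema over simple functions, with an explicit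
    measurable majorant on the larger side. Two constraints shape the comparison. The boundary
    limits of the kernel must dominate the indicator of the closed disc at every boundary point, but
    the kernel of [-r^p, r^p] does not tend to 1 at the end points; so one takes t > r^p and then
    lets t decrease to r^p. And the maximum principle needs the kernel to second order at each
    point, because the gain eps rho^2 due to eps |.|^2 must beat the error in the circle means. No
    Laplacian is formed: expansions without constant term are stable under composition, exp has one
    by real Taylor formulas, log inherits one as a local inverse, and (z + h)' = z' exp (p log (1 +
    h / z)). Existence of the balayage is a corollary of the estimate: radii being unbounded, every
    bounded Borel set lies in a disc to which it applies. *)

Section PlaneTopology.
Context {R : realType}.
Implicit Types (z w h : R[i]) (d e : R).

Lemma norm_complexE z : `|z| = (normc z)%:C%C.
Proof. by []. Qed.

Lemma normc_ge0 z : 0 <= normc z.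
Proof. by rewrite -lecR -norm_complexE; exact: (normr_ge0 z). Qed.

Lemma normc_gt0 z : (0 < normc z) = (z != 0).
Proof. by rewrite -ltcR -norm_complexE; exact: (normr_gt0 z). Qed.

(** Positive elements of [R[i]] are real, so the [R[i]]-valued radii of balls can be traded for real
    ones; the estimates below then use the real-valued [normc]. *)
Lemma nbhs_normcP z (P : set R[i]) :
  nbhs z P <-> exists2 d : R, 0 < d & forall w, normc (w - z) < d -> P w.
Proof.
split=> [/nbhs_ballP[e /= e0 zeP]|[d d0 zdP]].
  move: (e0) zeP => /gtr0_real/complex_realP[d eE].
  rewrite eE ltcR in e0 *.
  move=> zeP; exists d => // w wz; apply: zeP.
  by rewrite -ball_normE /ball_/= distrC norm_complexE ltcR.
apply/nbhs_ballP; exists d%:C%C => /=; first by rewrite ltcR.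
move=> w; rewrite -ball_normE /ball_/= distrC norm_complexE ltcR; exact: zdP.
Qed.

Lemma nbhs0_normcP (P : set R[i]) :
  nbhs (0 : R[i]) P <-> exists2 d : R, 0 < d & forall w, normc w < d -> P w.
Proof.
split=> [/nbhs_normcP[d d0 P0]|[d d0 P0]].
  by exists d => // w wd; apply: P0; rewrite subr0.
by apply/nbhs_normcP; exists d => // w; rewrite subr0; exact: P0.
Qed.

Lemma near0_normc d : 0 < d -> \forall h \near (0 : R[i]), normc h < d.
Proof. by move=> d0; apply/nbhs0_normcP; exists d. Qed.

Lemma Re_le_normc z : `|complex.Re z| <= normc z.
Proof. by rewrite -lecR -norm_complexE normc_ge_Re. Qed.

Lemma Im_le_normc z : `|complex.Im z| <= normc z.
Proof.
case: z => a b /=; rewrite -sqrtr_sqr ler_wsqrtr// lerDr; exact: sqr_ge0.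
Qed.

Lemma normc_sqr z : normc z ^+ 2 = complex.Re z ^+ 2 + complex.Im z ^+ 2.
Proof. by case: z => a b /=; rewrite sqr_sqrtr// addr_ge0 ?sqr_ge0. Qed.

Lemma normc_real (x : R) : normc x%:C%C = `|x|.
Proof. by rewrite /= expr0n addr0 sqrtr_sqr. Qed.

Lemma normcB z w : normc (z - w) = normc (w - z).
Proof. by rewrite -normcN opprB. Qed.

Lemma normc_le_ReIm z : normc z <= `|complex.Re z| + `|complex.Im z|.
Proof.
rewrite -(@ler_pXn2r _ 2) ?nnegrE ?normc_ge0 ?addr_ge0// normc_sqr sqrrD.
by rewrite !real_normK ?num_real// lerD2r lerDl mulrn_wge0 ?mulr_ge0.
Qed.

Lemma cvg_normcP (T : Type) (F : set_system T) (f : T -> R[i]) z :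
  Filter F ->
  f @ F --> z <-> forall e, 0 < e -> \forall t \near F, normc (f t - z) < e.
Proof.
move=> FF; split=> [fz e e0|fz A /nbhs_normcP[d d0 zA]].
  have /nbhs_normcP zd : exists2 d : R, 0 < d &
    forall w, normc (w - z) < d -> [set w | normc (w - z) < e] w by exists e.
  exact: (fz _ zd).
by have := fz d d0; apply: filterS => t; exact: zA.
Qed.

Lemma cvg_ReIm (T : Type) (F : set_system T) (f : T -> R[i]) z :
  Filter F -> (fun t => complex.Re (f t)) @ F --> complex.Re z ->
  (fun t => complex.Im (f t)) @ F --> complex.Im z -> f @ F --> z.
Proof.
move=> FF fR fI; apply/cvg_normcP => e e0.
near=> t; apply: (le_lt_trans (normc_le_ReIm _)).
have -> : e = e / 2 + e / 2 by field.
apply: ltrD; rewrite raddfB/= distrC; near: t.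
- by move/cvgrPdist_lt: fR; apply; rewrite divr_gt0.
- by move/cvgrPdist_lt: fI; apply; rewrite divr_gt0.
Unshelve. all: by end_near. Qed.

Lemma continuous_normcP (f : R[i] -> R) z :
  (forall e, 0 < e -> exists2 d, 0 < d &
    forall w, normc (w - z) < d -> `|f w - f z| < e) -> {for z, continuous f}.
Proof.
move=> fz A /nbhs_ballP[e /= e0 fzA]; apply/nbhs_normcP.
have [d d0 fd] := fz e e0; exists d => // w /fd wz; apply: fzA.
by rewrite /ball/= distrC.
Qed.

Lemma Re_continuous : continuous (@complex.Re R : R[i] -> R).
Proof.
move=> z; apply: continuous_normcP => e e0; exists e => // w wz.
by rewrite -raddfB; apply: le_lt_trans wz; exact: Re_le_normc.
Qed.

Lemma Im_continuous : continuous (@complex.Im R : R[i] -> R).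
Proof.
move=> z; apply: continuous_normcP => e e0; exists e => // w wz.
by rewrite -raddfB; apply: le_lt_trans wz; exact: Im_le_normc.
Qed.

Lemma normc_continuous : continuous (@normc R : R[i] -> R).
Proof.
move=> z; apply: continuous_normcP => e e0; exists e => // w wz.
rewrite -/(normc _) -/(normc _); apply: le_lt_trans wz; rewrite ler_norml; apply/andP; split.
  by rewrite lerNl opprB lerBlDr normcB -{1}(subrK w z) le_normcD.
by rewrite lerBlDr -{1}(subrK z w) le_normcD.
Qed.

Lemma closed_discE d : closed_disc d = [set z : R[i] | normc z <= d].
Proof. by apply/seteqP; split => z; rewrite /closed_disc/mkset norm_complexE lecR. Qed.

Lemma open_discE d : open_disc d = [set z : R[i] | normc z < d].
Proof. by apply/seteqP; split => z; rewrite /open_disc/mkset norm_complexE ltcR. Qed.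

Lemma closed_closed_disc d : closed (closed_disc d : set R[i]).
Proof.
rewrite closed_discE; apply: (@closed_comp _ _ _ [set x | x <= d]).
  by move=> x _; exact: normc_continuous.
exact: closed_le.
Qed.

Lemma open_open_disc d : open (open_disc d : set R[i]).
Proof.
rewrite open_discE; apply: (@open_comp _ _ _ [set x | x < d]).
  by move=> x _; exact: normc_continuous.
exact: open_lt.
Qed.

Lemma compact_closed_disc d : compact (closed_disc d : set R[i]).
Proof.
pose f (p : R * R) : R[i] := (p.1 +i* p.2)%C.
apply: (@subclosed_compact _ _ (f @` (`[-d, d]%classic `*` `[-d, d]%classic))).
- exact: closed_closed_disc.
- apply: continuous_compact; last by apply: compact_setX; exact: segment_compact.
  apply: continuous_subspaceT => p; apply: cvg_ReIm; rewrite /=.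
    exact: cvg_fst.
  exact: cvg_snd.
- rewrite closed_discE => -[x y] /= xyd; exists (x, y) => //=.
  rewrite !in_itv/= -!ler_norml; split.
    exact: le_trans (Re_le_normc (x +i* y)%C) xyd.
  exact: le_trans (Im_le_normc (x +i* y)%C) xyd.
Qed.

Lemma measurable_openC (A : set R[i]) : open A -> measurable A.
Proof. by move=> oA; apply: sub_sigma_algebra. Qed.

Lemma measurable_closedC (A : set R[i]) : closed A -> measurable A.
Proof.
by move=> cA; rewrite -(setCK A); apply: measurableC; apply: measurable_openC; exact: closed_openC.
Qed.

Lemma measurable_fun_open_continuous (A : set R[i]) (f : R[i] -> R) :
  open A -> (forall z, A z -> {for z, continuous f}) -> measurable_fun A f.
Proof.
move=> oA cf.
have oAf x : open (A `&` f @^-1` `]x, +oo[).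
  rewrite openE => z [Az /= fz]; apply: filterI.
    by apply: open_nbhs_nbhs; split.
  apply: cf => //; apply: open_nbhs_nbhs; split; last exact: fz.
  rewrite set_itvE; exact: open_gt.
apply: (@measurability _ _ _ (measurableTypeR R) A f _ (measurable_realfun.RGenOInfty.measurableE R)).
by move=> _ [_ [x ->] <-]; exact: measurable_openC.
Qed.

End PlaneTopology.

(** * Second-order complex expansions *)

Section RealTaylor.
Context {R : realType}.
Implicit Types (f df : R -> R) (x y a b e : R).

Lemma MVT_abs f df x : (forall y, is_derive y 1 f (df y)) ->
  exists2 c, `|c| <= `|x| & f x - f 0 = df c * x.
Proof.
move=> fdf.
have cf : continuous f.
  by move=> y; apply/differentiable_continuous/derivable1_diffP; case: (fdf y).
have [x0|x0] := leP 0 x.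
  have [|c] := @MVT_segment _ f df 0 x x0.
    exact: continuous_subspaceT.
  by rewrite in_itv/= => /andP[c0 cx] ->; exists c; rewrite ?subr0// !ger0_norm.
have [|c] := @MVT_segment _ f df x 0 (ltW x0).
  exact: continuous_subspaceT.
rewrite in_itv/= => /andP[xc c0] E; exists c; first by rewrite (ltr0_norm x0) ler0_norm// lerN2.
by rewrite -opprB E sub0r mulrN opprK.
Qed.

(** The remainder has derivative [df y - df 0 - b * y], which is o(|y|) by differentiability of [df]
    at 0 alone; the mean value theorem supplies the second factor |x|. *)
Lemma taylor2 f df b : (forall x, is_derive x 1 f (df x)) ->
  is_derive (0 : R) (1 : R) df b -> forall e, 0 < e ->
  exists2 d : R, 0 < d & forall x, `|x| < d ->
    `|f x - f 0 - df 0 * x - b / 2 * x ^+ 2| <= e * x ^+ 2.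
Proof.
move=> fdf dfb e e0.
have [d d0 dP] : exists2 d : R, 0 < d & forall y, `|y| < d ->
    `|df y - df 0 - b * y| <= e * `|y|.
  have : h^-1 *: ((df \o shift 0) (h *: 1) - df 0) @[h --> (0 : R)^'] --> b.
    by case: dfb => dfd <-; exact: dfd.
  move=> /cvgrPdist_le /(_ _ e0) /nbhs_ballP[d /= d0 dP].
  exists d => // y yd.
  have [->|y0] := eqVneq y 0; first by rewrite !subrr mulr0 subrr normr0 mulr0.
  have /dP : ball (0 : R) d y by rewrite /ball/= sub0r normrN.
  move=> /(_ y0); rewrite scaler1 addr0 -[_ *: _]/(_ * _) => H.
  rewrite -opprB normrN.
  have -> : b * y - (df y - df 0) = (b - y^-1 * (df y - df 0)) * y by field.
  by rewrite normrM ler_wpM2r.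
exists d => // x xd.
pose g x := f x - df 0 * x - b / 2 * x ^+ 2.
have gdg y : is_derive y 1 g (df y - df 0 - b * y).
  have := fdf y => ?; apply: is_derive_eq.
  by rewrite -![_ *: _]/(_ * _); field.
have [c cx] := MVT_abs x gdg.
rewrite /g mulr0 expr0n/= mulr0 !subr0 => E.
have -> : f x - f 0 - df 0 * x - b / 2 * x ^+ 2 =
  f x - df 0 * x - b / 2 * x ^+ 2 - f 0 by ring.
rewrite E normrM (le_trans (ler_wpM2r _ (dP _ (le_lt_trans cx xd))))//.
by rewrite -mulrA ler_pM2l// -(real_normK (num_real x)) expr2 ler_wpM2r.
Qed.

End RealTaylor.

Section Jets.
Context {R : realType}.
Implicit Types (f g : R[i] -> R[i]) (z w h k : R[i]) (e d : R).
Local Notation C0 := (0 : R[i]).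

(** There is no constant term, which is what makes these expansions compose at 0; the case h = 0
    forces f 0 = 0. *)
Definition jet2_at f z w := forall e, 0 < e ->
  \forall h \near C0, normc (f h - (z * h + w * h ^+ 2)) <= e * normc h ^+ 2.

Definition jet2 f := exists z w, jet2_at f z w.

Lemma normcX z n : normc (z ^+ n) = normc z ^+ n.
Proof. by elim: n => [|n IH]; rewrite ?normc1// !exprS normcM IH. Qed.

Lemma le_normcB z w : normc (z - w) <= normc z + normc w.
Proof. by rewrite -(normcN w) le_normcD. Qed.

Lemma jet2_linear_bound f : jet2 f ->
  exists2 M : R, 0 < M & \forall h \near C0, normc (f h) <= M * normc h.
Proof.
move=> [z [w fzw]]; exists (normc z + normc w + 1).
  by have := normc_ge0 z; have := normc_ge0 w; lra.
near=> h.
have h1 : normc h < 1 by near: h; exact: near0_normc.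
have H : normc (f h - (z * h + w * h ^+ 2)) <= 1 * normc h ^+ 2 by near: h; exact: fzw.
have -> : f h = (f h - (z * h + w * h ^+ 2)) + (z * h + w * h ^+ 2) by ring.
apply: (le_trans (le_normcD _ _)).
have H2 := le_normcD (z * h) (w * h ^+ 2).
rewrite (normcM z) (normcM w) normcX in H2.
have h0 := normc_ge0 h; have w0 := normc_ge0 w.
have h2 : normc h ^+ 2 <= normc h by rewrite expr2; nra.
have := ler_wpM2l w0 h2.
lra.
Unshelve. all: by end_near. Qed.

Lemma cvg0_normcP f : f @ C0 --> C0 <->
  forall e, 0 < e -> \forall h \near C0, normc (f h) < e.
Proof.
split=> [f0 e e0|f0 A /nbhs0_normcP[d d0 dA]].
  exact: (f0 _ (near0_normc e0)).
by have := f0 d d0; apply: filterS => t; exact: dA.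
Qed.

Lemma jet2_cvg0 f : jet2 f -> f @ C0 --> C0.
Proof.
move=> /jet2_linear_bound[M M0 fM]; apply/cvg0_normcP => e e0; near=> h.
have : normc (f h) <= M * normc h by near: h.
move/le_lt_trans; apply.
rewrite mulrC -ltr_pdivlMr//; near: h; apply: near0_normc; exact: divr_gt0.
Unshelve. all: by end_near. Qed.

Lemma jet2_mull k : jet2 (fun h => k * h).
Proof.
exists k, 0 => e e0; near=> h.
by rewrite mul0r addr0 subrr normc0 mulr_ge0 ?(ltW e0)// exprn_ge0 ?normc_ge0.
Unshelve. all: by end_near. Qed.

Lemma jet2B f g : jet2 f -> jet2 g -> jet2 (fun h => f h - g h).
Proof.
move=> [z [w fzw]] [z' [w' gzw]]; exists (z - z'), (w - w') => e e0; near=> h.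
have -> : f h - g h - ((z - z') * h + (w - w') * h ^+ 2) =
  (f h - (z * h + w * h ^+ 2)) - (g h - (z' * h + w' * h ^+ 2)) by ring.
apply: (le_trans (le_normcB _ _)).
have -> : e = e / 2 + e / 2 by field.
rewrite mulrDl; apply: lerD; near: h; [apply: fzw|apply: gzw]; exact: divr_gt0.
Unshelve. all: by end_near. Qed.

Lemma near_comp0 g (P : set R[i]) : g @ C0 --> C0 ->
  (\forall h \near C0, P h) -> \forall h \near C0, P (g h).
Proof. by move=> g0 P0; exact: (g0 _ P0). Qed.

(** With G = g h, the error splits into the remainder of [f] at G, the remainder of [g] times z, and
    w (G^2 - (z' h)^2). The last is factored as a difference, O(|h|^2), times a sum, O(|h|). Each
    part gets a third of e. *)
Lemma jet2_comp f g : jet2 f -> jet2 g -> jet2 (f \o g).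
Proof.
move=> [z [w fzw]] jg; have [M M0 gM] := jet2_linear_bound jg.
have g0 := jet2_cvg0 jg.
case: jg => [z' [w' gzw]].
exists (z * z'), (z * w' + w * z' ^+ 2) => e e0.
have e1 : 0 < e / (3 * M ^+ 2) by rewrite divr_gt0// mulr_gt0// exprn_gt0.
have fg := near_comp0 g0 (fzw _ e1).
near=> h => /=.
set n : R := normc h; set G := g h.
have n0 : 0 <= n := normc_ge0 h.
have nz := normc_ge0 z; have nw := normc_ge0 w; have nz' := normc_ge0 z'.
have nw' := normc_ge0 w'.
have GM : normc G <= M * n by rewrite /G /n; near: h.
have fG : normc (f G - (z * G + w * G ^+ 2)) <= e / (3 * M ^+ 2) * normc G ^+ 2.
  by rewrite /G; near: h.
have gh : normc (G - (z' * h + w' * h ^+ 2)) <= e / (3 * (normc z + 1)) * n ^+ 2.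
  by rewrite /G /n; near: h; apply: gzw; rewrite divr_gt0// mulr_gt0// ltr_wpDl ?normc_ge0.
have gh1 : normc (G - (z' * h + w' * h ^+ 2)) <= 1 * n ^+ 2.
  by rewrite /G /n; near: h; exact: gzw.
have hn : n < e / (3 * ((normc w + 1) * (normc w' + 1) * (M + normc z'))).
  rewrite /n; near: h; apply: near0_normc; apply: divr_gt0 => //.
  by have := normc_ge0 w; have := normc_ge0 w'; have := normc_ge0 z' => *; rewrite !mulr_gt0//; lra.
have -> : f G - (z * z' * h + (z * w' + w * z' ^+ 2) * h ^+ 2) =
  (f G - (z * G + w * G ^+ 2)) + (z * (G - (z' * h + w' * h ^+ 2)) +
   w * ((G - z' * h) * (G + z' * h))) by ring.
have T1 : normc (f G - (z * G + w * G ^+ 2)) <= e / 3 * n ^+ 2.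
  apply: (le_trans fG).
  have -> : e / 3 * n ^+ 2 = e / (3 * M ^+ 2) * (M * n) ^+ 2.
    by field; rewrite gt_eqF.
  apply: ler_wpM2l; first exact: ltW.
  by rewrite ler_sqr ?nnegrE ?normc_ge0// mulr_ge0// ltW.
have T2 : normc (z * (G - (z' * h + w' * h ^+ 2))) <= e / 3 * n ^+ 2.
  rewrite normcM.
  apply: (@le_trans _ _ ((normc z + 1) * (e / (3 * (normc z + 1)) * n ^+ 2))).
    by apply: ler_pM => //; [exact: normc_ge0|rewrite lerDl].
  by rewrite le_eqVlt; apply/orP; left; apply/eqP; field; rewrite gt_eqF// ltr_wpDl.
have D1 : normc (G - z' * h) <= (normc w' + 1) * n ^+ 2.
  have -> : G - z' * h = (G - (z' * h + w' * h ^+ 2)) + w' * h ^+ 2 by ring.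
  apply: (le_trans (le_normcD _ _)); rewrite normcM normcX -/n.
  by rewrite mulrDl addrC lerD2l.
have D2 : normc (G + z' * h) <= (M + normc z') * n.
  by apply: (le_trans (le_normcD _ _)); rewrite normcM -/n mulrDl lerD2r.
have T3 : normc (w * ((G - z' * h) * (G + z' * h))) <= e / 3 * n ^+ 2.
  rewrite !normcM.
  apply: (@le_trans _ _ ((normc w + 1) * (((normc w' + 1) * n ^+ 2) * ((M + normc z') * n)))).
    apply: ler_pM => //; rewrite ?mulr_ge0 ?normc_ge0 ?lerDl//.
    by apply: ler_pM; rewrite ?normc_ge0.
  have -> : (normc w + 1) * (((normc w' + 1) * n ^+ 2) * ((M + normc z') * n)) =
    ((normc w + 1) * (normc w' + 1) * (M + normc z')) * n * n ^+ 2 by ring.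
  rewrite ler_wpM2r ?exprn_ge0// mulrC -ler_pdivlMr.
    by apply: le_trans (ltW hn) _; rewrite invfM mulrA.
  by have := normc_ge0 w; have := normc_ge0 w'; have := normc_ge0 z' => *; rewrite !mulr_gt0//; lra.
apply: (le_trans (le_normcD _ _)).
have T4 := le_normcD (z * (G - (z' * h + w' * h ^+ 2))) (w * ((G - z' * h) * (G + z' * h))).
lra.
Unshelve. all: by end_near. Qed.

(** Put l = g h. The crude estimate |h - l| <= |l|^2 gives |l| <= 2 |h|; then l - h + h^2 / 2 is
    half of h^2 - l^2 up to the remainder of [f], and h^2 - l^2 is O(|h|^3). *)
Lemma jet2_at_inverse f g : jet2_at f 1 2^-1 -> g @ C0 --> C0 ->
  (\forall h \near C0, f (g h) = h) -> jet2_at g 1 (- 2^-1).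
Proof.
move=> jf g0 fgK e e0.
(* [u <= 1/4] serves the crude bound, and [u <= e / 8] gives u |l|^2 <= e |h|^2 / 2; the cubic term
   6 |h|^3 takes the other half through |h| < e / 12. *)
pose u := Num.min (4^-1) (e / 8).
have u0 : 0 < u by rewrite lt_min !divr_gt0// invr_gt0 ltr0n.
have fg := near_comp0 g0 (jf _ u0).
have i4 : 0 < 4^-1 :> R by rewrite invr_gt0.
have g4 := near_comp0 g0 (near0_normc i4).
near=> h.
set n : R := normc h; set l := g h.
have n0 : 0 <= n := normc_ge0 h.
have l0 : 0 <= normc l := normc_ge0 l.
have fl : f l = h by rewrite /l; near: h.
have jl : normc (f l - (1 * l + 2^-1 * l ^+ 2)) <= u * normc l ^+ 2.
  by rewrite /l; near: h.
have u4 : u <= 4^-1 by rewrite ge_min lexx.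
have u8 : u <= e / 8 by rewrite ge_min lexx orbT.
have l4 : normc l < 4^-1.
  by rewrite /l; near: h.
have n4 : n < e / 12 by rewrite /n; near: h; apply: near0_normc; exact: divr_gt0.
rewrite fl mul1r in jl.
have half : normc (2^-1 : R[i]) = 2^-1.
  by rewrite normcV -(natr1 1) -[1 + 1]/(1%:C%C + 1%:C%C) -rmorphD normc_real ger0_norm.
have hl : normc (h - l) <= normc l ^+ 2.
  have -> : h - l = (h - (l + 2^-1 * l ^+ 2)) + 2^-1 * l ^+ 2 by ring.
  apply: (le_trans (le_normcD _ _)); rewrite normcM normcX half.
  have : 0 <= normc l ^+ 2 by exact: sqr_ge0.
  nra.
have ln : normc l <= 2 * n.
  have : normc l <= normc h + normc (h - l).
    have -> : normc l = normc (h - (h - l)) by congr normc; ring.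
    exact: le_normcB.
  rewrite -/n; nra.
have -> : l - (1 * h + - 2^-1 * h ^+ 2) =
  2^-1 * ((h - l) * (h + l)) - (h - (l + 2^-1 * l ^+ 2)) by field.
apply: (le_trans (le_normcB _ _)); rewrite !normcM half.
have hl2 := le_normcD h l.
have : normc (h - l) * normc (h + l) <= normc l ^+ 2 * (n + normc l).
  by apply: ler_pM; rewrite ?normc_ge0.
have : normc l ^+ 2 <= 4 * n ^+ 2 by nra.
have : 0 <= n ^+ 2 by exact: sqr_ge0.
have : normc l ^+ 2 * (n + normc l) <= (4 * n ^+ 2) * (3 * n).
  by apply: ler_pM; rewrite ?sqr_ge0 ?addr_ge0//; [nra|lra].
nra.
Unshelve. all: by end_near. Qed.

End Jets.

(** * Complex exponential and logarithm *)

Section ComplexExpLog.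
Context {R : realType}.
Implicit Types (z w h : R[i]) (s t x y e d : R).
Local Notation C0 := (0 : R[i]).

Definition cexp z : R[i] := (expR (complex.Re z))%:C%C * cis (complex.Im z).

Lemma cisD s t : cis (s + t) = cis s * cis t.
Proof.
apply/eqP; rewrite eq_complex /= cosD sinD; apply/andP; split; apply/eqP => //.
ring.
Qed.

Lemma cis0 : cis 0 = 1 :> R[i].
Proof. by rewrite /cis cos0 sin0. Qed.

Lemma normc_cis t : normc (cis t) = 1.
Proof. by rewrite /= cos2Dsin2 sqrtr1. Qed.

Lemma normc_cexp z : normc (cexp z) = expR (complex.Re z).
Proof. by rewrite normcM normc_cis mulr1 normc_real ger0_norm// expR_ge0. Qed.

Lemma cexp_neq0 z : cexp z != 0.
Proof. by rewrite -normc_gt0 normc_cexp expR_gt0. Qed.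

(** Bookkeeping for the real and imaginary parts of the second-order remainder of exp (x + iy), from
    the real remainders of exp, cos and sin. The cross terms are of order n^3, and [n <= u / 2]
    absorbs them into u n^2; the constant 8 is generous. *)
Lemma exp_cis_taylor_bound (x y ex c s u n : R) : 0 < u -> u <= 1 -> n <= u / 2 ->
  `|x| <= n -> `|y| <= n -> `|ex - 1 - x - x ^+ 2 / 2| <= u * x ^+ 2 ->
  `|c - 1 + y ^+ 2 / 2| <= u * y ^+ 2 -> `|s - y| <= u * y ^+ 2 ->
  `|ex * c - 1 - x - (x ^+ 2 - y ^+ 2) / 2| + `|ex * s - y - x * y| <=
  8 * u * n ^+ 2.
Proof.
move=> u0 u1 nu xn yn.
have n0 : 0 <= n := le_trans (normr_ge0 x) xn.
have sq (z : R) : `|z| <= n -> z ^+ 2 <= n ^+ 2.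
  by move=> zn; rewrite -(real_normK (num_real z)) ler_sqr ?nnegrE.
have x2 := sq _ xn; have y2 := sq _ yn.
have x20 := sqr_ge0 x; have y20 := sqr_ge0 y; have n20 := sqr_ge0 n.
set A := ex - 1 - x - x ^+ 2 / 2; set C := c - 1 + y ^+ 2 / 2; set S := s - y.
move=> HA HC HS.
have {}HA : `|A| <= u * n ^+ 2 by apply: (le_trans HA); rewrite ler_pM2l.
have {}HC : `|C| <= u * n ^+ 2 by apply: (le_trans HC); rewrite ler_pM2l.
have {}HS : `|S| <= u * n ^+ 2 by apply: (le_trans HS); rewrite ler_pM2l.
have n3 : n ^+ 3 <= u / 2 * n ^+ 2 by rewrite exprS ler_wpM2r.
have un : u * n ^+ 2 <= n ^+ 2 by rewrite ler_piMl.
have P1 : `|ex - 1 - x| <= 3 / 2 * n ^+ 2.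
  have -> : ex - 1 - x = A + x ^+ 2 / 2 by rewrite /A; ring.
  apply: (le_trans (ler_normD _ _)); rewrite (ger0_norm (_ : 0 <= x ^+ 2 / 2)); lra.
have n2n : n ^+ 2 <= n / 2 by rewrite expr2; nra.
have P0 : `|ex - 1| <= 2 * n.
  have -> : ex - 1 = (ex - 1 - x) + x by ring.
  apply: (le_trans (ler_normD _ _)); lra.
have Q0 : `|c - 1| <= 3 / 2 * n ^+ 2.
  have -> : c - 1 = C - y ^+ 2 / 2 by rewrite /C; ring.
  apply: (le_trans (ler_normB _ _)); rewrite (ger0_norm (_ : 0 <= y ^+ 2 / 2)); lra.
have M1 : `|(ex - 1) * (c - 1)| <= 3 * n ^+ 3.
  rewrite normrM; apply: (le_trans (ler_pM _ _ P0 Q0)) => //.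
  by rewrite le_eqVlt; apply/orP; left; apply/eqP; field.
have M2 : `|(ex - 1 - x) * y| <= 3 / 2 * n ^+ 3.
  rewrite normrM; apply: (le_trans (ler_pM _ _ P1 yn)) => //.
  by rewrite le_eqVlt; apply/orP; left; apply/eqP; field.
have M3 : `|(ex - 1) * S| <= 2 * n ^+ 3.
  rewrite normrM; apply: (le_trans (ler_pM _ _ P0 (le_trans HS un))) => //.
  by rewrite le_eqVlt; apply/orP; left; apply/eqP; field.
have -> : ex * c - 1 - x - (x ^+ 2 - y ^+ 2) / 2 = A + (C + (ex - 1) * (c - 1)).
  by rewrite /A /C; field.
have -> : ex * s - y - x * y = S + ((ex - 1 - x) * y + (ex - 1) * S).
  by rewrite /S; ring.
have := ler_normD A (C + (ex - 1) * (c - 1)); have := ler_normD C ((ex - 1) * (c - 1)).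
have := ler_normD S ((ex - 1 - x) * y + (ex - 1) * S).
have := ler_normD ((ex - 1 - x) * y) ((ex - 1) * S).
have un0 : 0 <= u * n ^+ 2 by rewrite mulr_ge0// ltW.
lra.
Qed.

Lemma cexp_remainderE h :
  cexp h - 1 - (1 * h + 2^-1 * h ^+ 2) =
  ((expR (complex.Re h) * cos (complex.Im h) - 1 - complex.Re h -
    (complex.Re h ^+ 2 - complex.Im h ^+ 2) / 2) +i*
   (expR (complex.Re h) * sin (complex.Im h) - complex.Im h -
    complex.Re h * complex.Im h))%C.
Proof.
have -> : 2^-1 = (2^-1 : R)%:C%C :> R[i] by rewrite fmorphV rmorph_nat.
rewrite expr2; case: h => x y.
by apply/eqP; rewrite eq_complex /=; apply/andP; split; apply/eqP; field.
Qed.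

Lemma jet2_at_expm1 : jet2_at (fun h => cexp h - 1) 1 2^-1.
Proof.
move=> e e0.
pose u := Num.min 1 (e / 8).
have u0 : 0 < u by rewrite lt_min ltr01 divr_gt0.
have u1 : u <= 1 by rewrite ge_min lexx.
have ue : u <= e / 8 by rewrite ge_min lexx orbT.
have D1 : is_derive (0 : R) 1 expR (1 : R) by apply: is_derive_eq; rewrite expR0.
have D2 : is_derive (0 : R) 1 (@cos R) 0 by apply: is_derive_eq; rewrite sin0 oppr0.
have D3 : is_derive (0 : R) 1 (fun x : R => - sin x) (-1).
  by apply: is_derive_eq; rewrite cos0.
have [d1 d1_0 P1] := @taylor2 R expR expR 1 (fun x => is_derive_expR x) D1 u u0.
have [d2 d2_0 P2] := @taylor2 R sin cos 0 (fun x => is_derive_sin x) D2 u u0.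
have [d3 d3_0 P3] := @taylor2 R cos (fun x => - sin x) (-1) (fun x => is_derive_cos x) D3 u u0.
near=> h.
have h1 : normc h < d1 by near: h; exact: near0_normc.
have h2 : normc h < d2 by near: h; exact: near0_normc.
have h3 : normc h < d3 by near: h; exact: near0_normc.
have hu : normc h < u / 2 by near: h; apply: near0_normc; exact: divr_gt0.
have hR := Re_le_normc h; have hI := Im_le_normc h.
have Q1 := P1 _ (le_lt_trans hR h1).
have Q2 := P2 _ (le_lt_trans hI h2).
have Q3 := P3 _ (le_lt_trans hI h3).
apply: (le_trans (normc_le_ReIm _)).
rewrite cexp_remainderE /=.
apply: (@le_trans _ _ (8 * u * normc h ^+ 2)).
  apply: exp_cis_taylor_bound => //; first exact: ltW.
  - move: Q1; rewrite expR0 !mul1r mulrC; congr (`|_| <= _); by field.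
  - move: Q3; rewrite cos0 sin0; congr (`|_| <= _); by field.
  - have -> : sin (complex.Im h) - complex.Im h = sin (complex.Im h) - sin 0 -
      cos 0 * complex.Im h - 0 / 2 * complex.Im h ^+ 2 by rewrite sin0 cos0; field.
    exact: Q2.
rewrite ler_wpM2r ?exprn_ge0 ?normc_ge0//; lra.
Unshelve. all: by end_near. Qed.

Lemma polar_Re_gt0 w : 0 < complex.Re w ->
  w = (normc w)%:C%C * cis (atan (complex.Im w / complex.Re w)).
Proof.
case: w => x y /= x0.
set q := y / x.
have s0 : 0 < Num.sqrt (1 + q ^+ 2) by rewrite sqrtr_gt0 ltr_wpDr ?sqr_ge0.
have nE : Num.sqrt (x ^+ 2 + y ^+ 2) = x * Num.sqrt (1 + q ^+ 2).
  have -> : x ^+ 2 + y ^+ 2 = x ^+ 2 * (1 + q ^+ 2) by rewrite /q; field; rewrite gt_eqF.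
  by rewrite sqrtrM ?sqr_ge0// sqrtr_sqr gtr0_norm.
have cE : cos (atan q) = (Num.sqrt (1 + q ^+ 2))^-1 by rewrite cos_atan.
have c0 : cos (atan q) != 0 by rewrite cE invr_eq0 gt_eqF.
have sE : sin (atan q) = q * cos (atan q).
  by rewrite -{2}(atanK q) /tan divfK.
rewrite nE; apply/eqP; rewrite eq_complex /= sE cE !mul0r subr0 addr0.
apply/andP; split; apply/eqP; first by field; rewrite gt_eqF.
by rewrite /q; field; rewrite !gt_eqF.
Qed.

(** Principal branch of log (1 + h), valid where Re (1 + h) > 0. *)
Definition clog1 h : R[i] := (ln (normc (1 + h)) +i*
  atan (complex.Im (1 + h) / complex.Re (1 + h)))%C.

Lemma clog1K h : 0 < complex.Re (1 + h) -> cexp (clog1 h) = 1 + h.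
Proof.
move=> h0; rewrite /cexp /clog1 [complex.Re _]/= [complex.Im (_ +i* _)%C]/=.
rewrite lnK -?polar_Re_gt0// posrE normc_gt0.
by apply: contraTneq h0 => ->; rewrite ltxx.
Qed.

Lemma near0_Re1D : \forall h \near C0, 0 < complex.Re (1 + h).
Proof.
near=> h; rewrite raddfD/=.
have : normc h < 1 by near: h; exact: near0_normc.
have := Re_le_normc h; rewrite ler_norml => /andP[H _] h1.
lra.
Unshelve. all: by end_near. Qed.

Lemma clog1_cvg0 : clog1 @ C0 --> C0.
Proof.
have c1 : {for C0, continuous (fun h : R[i] => 1 + h)}.
  move=> A /nbhs_normcP[d d0 dA]; apply/nbhs_normcP; exists d => // w wd.
  by apply: dA; move: wd; congr (normc _ < d); ring.
have cR : {for C0, continuous (fun h : R[i] => complex.Re (1 + h))}.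
  by apply: (continuous_comp c1); exact: Re_continuous.
have cI : {for C0, continuous (fun h : R[i] => complex.Im (1 + h))}.
  by apply: (continuous_comp c1); exact: Im_continuous.
have cN : {for C0, continuous (fun h : R[i] => normc (1 + h))}.
  by apply: (continuous_comp c1); exact: normc_continuous.
apply: (@cvg_ReIm _ _ _ _ _ (nbhs_filter C0)); rewrite /clog1 /=.
  have N1 : normc (1 + C0) = 1 by rewrite addr0; exact: normc1.
  have : (fun t : R[i] => ln (normc (1 + t))) @ C0 --> ln (normc (1 + C0)).
    by apply: (continuous_comp cN); rewrite N1; exact: continuous_ln.
  by rewrite N1 ln1.
have q0 : complex.Im (1 + C0) / complex.Re (1 + C0) = 0 by rewrite addr0 mul0r.
have cq : {for C0, continuous (fun h : R[i] => complex.Im (1 + h) / complex.Re (1 + h))}.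
  by apply: (cvgM cI); apply: cvgV; [rewrite addr0 oner_neq0|exact: cR].
have : (fun t : R[i] => atan (complex.Im (1 + t) / complex.Re (1 + t))) @ C0 -->
    atan (complex.Im (1 + C0) / complex.Re (1 + C0)).
  by apply: (continuous_comp cq); exact: continuous_atan.
by rewrite q0 atan0.
Qed.

(** As a local inverse of exp - 1, the logarithm gets its expansion from mere continuity at 0,
    without differentiating [ln] or [atan]. *)
Lemma jet2_clog1 : jet2 clog1.
Proof.
exists 1, (- 2^-1); apply: jet2_at_inverse jet2_at_expm1 clog1_cvg0 _.
near=> h; rewrite clog1K; first by rewrite addrC addKr.
by near: h; exact: near0_Re1D.
Unshelve. all: by end_near. Qed.

Lemma jet2_cexpm1 : jet2 (fun h => cexp h - 1).
Proof. by exists 1, 2^-1; exact: jet2_at_expm1. Qed.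

End ComplexExpLog.

(** * Arguments and angles *)

Section Arguments.
Context {R : realType}.
Implicit Types (z w h : R[i]) (s t x y e d al be : R).

Lemma cisN t : cis (- t) = (cis t)^-1 :> R[i].
Proof.
have c0 : cis t != 0 :> R[i] by rewrite -normc_gt0 normc_cis.
by apply: (mulfI c0); rewrite divff// -cisD subrr cis0.
Qed.

(** cos t = 1 gives sin (|t| / 2) = 0, and |t| / 2 lies in [0, pi[, where sin vanishes only at 0. *)
Lemma cis_eq1 t : `|t| < 2 * pi -> cis t = 1 :> R[i] -> t = 0.
Proof.
move=> tpi [c1 _].
have : sin (`|t| / 2) = 0.
  have t2 : `|t| / 2 *+ 2 = `|t| by rewrite -mulr_natr divfK ?pnatr_eq0.
  have := cos_mulr2n (`|t| / 2); rewrite t2 cos2sin2 cos_norm c1 => H; apply/eqP; rewrite -sqrf_eq0; apply/eqP; lra.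
have [->//|t0] := eqVneq t 0.
suff /lt0r_neq0/eqP : 0 < sin (`|t| / 2) by [].
by apply: sin_gt0_pi; rewrite divr_gt0 ?normr_gt0//= ltr_pdivrMr// mulrC.
Qed.

Lemma cis_inj s t : `|s - t| < 2 * pi -> cis s = cis t :> R[i] -> s = t.
Proof.
move=> st E; apply/eqP; rewrite -subr_eq0; apply/eqP/cis_eq1 => //.
by rewrite cisD E cisN divff// -normc_gt0 normc_cis.
Qed.

Lemma cis_periodz t (k : int) : cis (t + 2 * pi * k%:~R) = cis t :> R[i].
Proof.
have cn n : cis (t + 2 * pi * n%:R) = cis t :> R[i].
  by rewrite /cis mulr_natr mulr_natl (periodicn (@cosD2pi R)) (periodicn (@sinD2pi R)).
case: k => n; first exact: cn.
rewrite NegzE mulrNz mulrN cisD cisN; have := cn n.+1; rewrite cisD => E.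
have c0 : cis (2 * pi * n.+1%:R) != 0 :> R[i] by rewrite -normc_gt0 normc_cis.
by apply: (mulIf c0); rewrite mulfVK// E.
Qed.

Lemma is_argE z t : is_arg z t <-> z = (normc z)%:C%C * cis t.
Proof. by []. Qed.

Lemma is_argM z w s t : is_arg z s -> is_arg w t -> is_arg (z * w) (s + t).
Proof.
rewrite !is_argE normcM rmorphM cisD => {1}-> {1}->; ring.
Qed.

Lemma is_arg_polar x t : 0 <= x -> is_arg (x%:C%C * cis t) t.
Proof. by move=> x0; rewrite is_argE normcM normc_cis mulr1 normc_real ger0_norm. Qed.

Lemma is_arg_cis t : is_arg (cis t) t.
Proof. by rewrite is_argE normc_cis mul1r. Qed.

Lemma is_arg_mod z s t : z != 0 -> is_arg z s -> is_arg z t -> cis s = cis t :> R[i].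
Proof.
rewrite !is_argE => z0 zs zt; have n0 : (normc z)%:C%C != 0 :> R[i].
  by rewrite -normc_gt0 normc_real normr_gt0 gt_eqF ?normc_gt0.
by apply: (mulfI n0); rewrite -zs -zt.
Qed.

Lemma is_arg_uniq z s t : z != 0 -> `|s - t| < 2 * pi -> is_arg z s ->
  is_arg z t -> s = t.
Proof. by move=> z0 st zs zt; apply: cis_inj => //; exact: is_arg_mod zs zt. Qed.

Lemma cexp_is_arg z : is_arg (cexp z) (complex.Im z).
Proof. by apply: is_arg_polar; exact: expR_ge0. Qed.

(** The arctangent settles Re z > 0; the factor -1 carries this to Re z < 0, and the imaginary axis
    comes from the factor i. *)
Lemma is_arg_exists z : exists t, is_arg z t.
Proof.
have H w : 0 < complex.Re w -> is_arg w (atan (complex.Im w / complex.Re w)).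
  by move=> w0; rewrite is_argE -polar_Re_gt0.
have iE : is_arg ('i%C : R[i]) (pi / 2).
  by rewrite is_argE /cis cos_pihalf sin_pihalf/= expr0n/= add0r expr1n sqrtr1 mul1r.
have N1E : is_arg (- 1 : R[i]) pi.
  rewrite is_argE /cis cospi sinpi normcN normc1 mul1r.
  by apply/eqP; rewrite eq_complex /= oppr0 !eqxx.
have [z0|z0|z0] := ltgtP (complex.Re z) 0.
- have /H : 0 < complex.Re (- z) by rewrite raddfN/= oppr_gt0.
  by move=> /is_argM /(_ N1E); rewrite mulrN1 opprK => H2; eexists; exact: H2.
- by exists (atan (complex.Im z / complex.Re z)); exact: H.
have r (x : R) : 0 <= x -> is_arg (x%:C%C : R[i]) 0.
  by move=> x0; rewrite is_argE normc_real ger0_norm// cis0 mulr1.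
have zE : z = (complex.Im z)%:C%C * 'i%C.
  by case: z z0 => x y /= ->; apply/eqP; rewrite eq_complex /= !mul0r !mulr0 mulr1 subr0 addr0 !eqxx.
have [y0|y0] := leP 0 (complex.Im z).
  by rewrite zE; eexists; apply: is_argM iE; exact: r.
have := is_argM (is_argM (r (- complex.Im z) _) iE) N1E.
rewrite mulrN1 rmorphN/= mulNr opprK -zE => HH; eexists; apply: HH.
by rewrite oppr_ge0 ltW.
Qed.

Lemma is_arg_shift z t (k : int) : is_arg z t -> is_arg z (t + 2 * pi * k%:~R).
Proof. by rewrite !is_argE cis_periodz. Qed.

Lemma twopi_gt0 : 0 < 2 * pi :> R.
Proof. by rewrite mulr_gt0// pi_gt0. Qed.

Lemma shift_window t s : exists k : int, s <= t + 2 * pi * k%:~R < s + 2 * pi.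
Proof.
exists (- Num.floor ((t - s) / (2 * pi))).
have := floor_itv ((t - s) / (2 * pi)); have p0 := twopi_gt0.
rewrite rmorphN rmorphD/=; set f := (Num.floor _)%:~R => /andP[].
by rewrite ler_pdivlMr// ltr_pdivrMr// => H1 H2; apply/andP; split; lra.
Qed.

Lemma is_arg_window z s : exists2 t, s <= t < s + 2 * pi & is_arg z t.
Proof.
have [t zt] := is_arg_exists z; have [k kP] := shift_window t s.
by exists (t + 2 * pi * k%:~R) => //; exact: is_arg_shift.
Qed.

(** Writing z + h = z (1 + h / z) gives a branch of the argument around z without choosing a cut. *)
Lemma near_is_arg z t : z != 0 -> is_arg z t ->
  \forall h \near (0 : R[i]), [/\ z + h = z * cexp (clog1 (h / z)),
    z + h != 0 & is_arg (z + h) (t + complex.Im (clog1 (h / z)))].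
Proof.
move=> z0 zt.
have hz : (fun h : R[i] => z^-1 * h) @ (0 : R[i]) --> (0 : R[i]).
  exact: jet2_cvg0 (jet2_mull z^-1).
have H := near_comp0 hz (@near0_Re1D R).
near=> h.
have h1 : 0 < complex.Re (1 + h / z) by rewrite [h / z]mulrC; near: h.
have E : z + h = z * cexp (clog1 (h / z)) by rewrite clog1K// mulrDr mulr1 mulrC divfK.
split=> //; first by rewrite E mulf_neq0// cexp_neq0.
by rewrite E; apply: is_argM => //; exact: cexp_is_arg.
Unshelve. all: by end_near. Qed.

Lemma near_Im_clog1 z e : z != 0 -> 0 < e ->
  \forall h \near (0 : R[i]), `|complex.Im (clog1 (h / z))| < e.
Proof.
move=> z0 e0.
have hz : (fun h : R[i] => z^-1 * h) @ (0 : R[i]) --> (0 : R[i]).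
  exact: jet2_cvg0 (jet2_mull z^-1).
have /cvg0_normcP/(_ e e0) H := @clog1_cvg0 R.
have H2 := near_comp0 hz H.
near=> h; apply: (le_lt_trans (Im_le_normc _)); rewrite [h / z]mulrC; near: h.
exact: H2.
Unshelve. all: by end_near. Qed.

Lemma near_shift z (P : set R[i]) :
  (\forall h \near (0 : R[i]), P (z + h)) -> nbhs z P.
Proof.
move=> /nbhs0_normcP[d d0 dP]; apply/nbhs_normcP; exists d => // w wd.
by have := dP _ wd; rewrite addrC subrK.
Qed.

Lemma open_angle al be : open (angle al be : set R[i]).
Proof.
rewrite openE => z [z0 [t /andP[alt tbe] zt]].
pose e := Num.min (t - al) (be - t).
have e0 : 0 < e by rewrite lt_min !subr_gt0 alt.
apply: near_shift.
have H1 := near_is_arg z0 zt; have H2 := near_Im_clog1 z0 e0.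
near=> h.
have [_ zh0 zh] : [/\ z + h = z * cexp (clog1 (h / z)),
    z + h != 0 & is_arg (z + h) (t + complex.Im (clog1 (h / z)))] by near: h.
have : `|complex.Im (clog1 (h / z))| < e by near: h.
rewrite lt_min !ltr_norml => /andP[/andP[H3 _] /andP[_ H4]].
split=> //; exists (t + complex.Im (clog1 (h / z))) => //; lra.
Unshelve. all: by end_near. Qed.

Lemma arg_inE de w t : de <= 2 * pi -> w != 0 -> 0 < t < de -> is_arg w t ->
  arg_in de w = t.
Proof.
move=> de2 w0 tde wt; rewrite /arg_in; case: xgetP => [s _ [sde ws]|/(_ t)[]//].
move/andP: tde sde => [t0 td] /andP[s0 sd].
by apply: is_arg_uniq ws wt => //; rewrite ltr_norml; apply/andP; split; lra.
Qed.

Lemma angle_mapE al be z t : al < be <= al + 2 * pi -> z != 0 ->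
  al < t < be -> is_arg z t ->
  angle_map al be z =
  ((normc z) `^ (pi / (be - al)))%:C%C * cis (pi / (be - al) * (t - al)).
Proof.
move=> /andP[albe be2] z0 /andP[alt tbe] zt; rewrite /angle_map.
have c0 : cis (- al) != 0 :> R[i] by rewrite -normc_gt0 normc_cis.
rewrite norm_complexE /= normcM normc_cis mulr1 (@arg_inE _ _ (t - al)) ?mulf_neq0//.
- by rewrite lerBlDl.
- by rewrite subr_gt0 alt/= ltrD2r.
- by apply: is_argM => //; exact: is_arg_cis.
Qed.

(** Since (z + h)' = z' exp (p log (1 + h / z)), the relative increment is a composition of maps
    that have second-order expansions. *)
Lemma angle_map_jet al be z : al < be <= al + 2 * pi -> angle al be z ->
  exists2 q : R[i] -> R[i], jet2 q &
    \forall h \near (0 : R[i]), angle al be (z + h) /\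
      angle_map al be (z + h) = angle_map al be z * (1 + q h).
Proof.
move=> ab zab; have [z0 [t tab zt]] := zab.
pose p := pi / (be - al).
exists (fun h => cexp (p%:C%C * clog1 (z^-1 * h)) - 1).
  apply: (@jet2_comp _ (fun h => cexp h - 1) (fun h => p%:C%C * clog1 (z^-1 * h))).
    exact: jet2_cexpm1.
  apply: (@jet2_comp _ (fun h => p%:C%C * h) (fun h => clog1 (z^-1 * h))).
    exact: jet2_mull.
  by apply: (@jet2_comp _ (@clog1 R) (fun h => z^-1 * h)); [exact: jet2_clog1|exact: jet2_mull].
pose e := Num.min (t - al) (be - t).
have e0 : 0 < e by move/andP: tab => [? ?]; rewrite lt_min !subr_gt0; apply/andP.
have H1 := near_is_arg z0 zt; have H2 := near_Im_clog1 z0 e0.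
near=> h.
have [zhE zh0 zh] : [/\ z + h = z * cexp (clog1 (h / z)),
    z + h != 0 & is_arg (z + h) (t + complex.Im (clog1 (h / z)))] by near: h.
have : `|complex.Im (clog1 (h / z))| < e by near: h.
rewrite lt_min !ltr_norml => /andP[/andP[H3 _] /andP[_ H4]].
have tab' : al < t + complex.Im (clog1 (h / z)) < be by lra.
split; first by split=> //; exists (t + complex.Im (clog1 (h / z))).
rewrite (angle_mapE ab z0 tab zt) (angle_mapE ab zh0 tab' zh) -/p [1 + _]addrC subrK.
rewrite {1}zhE normcM normc_cexp powRM ?normc_ge0 ?expR_ge0// [h / z]mulrC.
set l := clog1 _.
have -> : expR (complex.Re l) `^ p = expR (p * complex.Re l) by rewrite -expRM mulrC.
rewrite /cexp.
have -> : complex.Re (p%:C%C * l) = p * complex.Re l by case: l => a b /=; ring.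
have -> : complex.Im (p%:C%C * l) = p * complex.Im l by case: l => a b /=; ring.
have -> : p * (t + complex.Im l - al) = p * (t - al) + p * complex.Im l by ring.
by rewrite cisD rmorphM/=; ring.
Unshelve. all: by end_near. Qed.

Lemma closed_max (A : set R) : closed A -> A !=set0 -> has_ubound A ->
  exists2 m, A m & forall x, A x -> x <= m.
Proof.
move=> cA A0 uA; exists (sup A); last by move=> x Ax; exact: ub_le_sup.
by apply: cA; exact: closure_sup.
Qed.

Lemma closed_min (A : set R) : closed A -> A !=set0 -> has_lbound A ->
  exists2 m, A m & forall x, A x -> m <= x.
Proof.
move=> cA [a Aa] [l lA].
have [m Am mA] : exists2 m, [set x | A (- x)] m & forall x, A (- x) -> x <= m.
  apply: closed_max.
  - by apply: (@closed_comp _ _ (fun x : R => - x)) => // x _; exact: opp_continuous.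
  - by exists (- a); rewrite /= opprK.
  - by exists (- l) => x /= /lA; rewrite lerNr.
by exists (- m) => // x Ax; rewrite lerNl; apply: mA; rewrite opprK.
Qed.

Lemma cis_continuous : continuous (@cis R).
Proof.
by move=> t; apply: cvg_ReIm; [exact: continuous_cos|exact: continuous_sin].
Qed.

(** In the coordinates log |z| and arg z the angle is a convex strip, so each point is joined to
    [cis m] by the image of a segment, an arc of a logarithmic spiral; a straight segment could
    leave an angle of opening larger than pi. *)
Lemma connected_angle al be : al < be -> connected (angle al be : set R[i]).
Proof.
move=> albe.
pose m := (al + be) / 2.
have am : al < m < be by rewrite /m; lra.
pose f (s t x : R) : R[i] := (expR (x * s))%:C%C * cis (m + x * (t - m)).
have fE s t x : f s t x = ((expR (x * s) * cos (m + x * (t - m))) +i*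
   (expR (x * s) * sin (m + x * (t - m))))%C.
  by apply/eqP; rewrite eq_complex /= !mul0r subr0 addr0 !eqxx.
have -> : angle al be = \bigcup_(i in [set i : R * R | al < i.2 < be])
    (f i.1 i.2 @` `[0, 1]%classic).
  apply/seteqP; split => [z [z0 [t tab zt]]|z [[s t] /= tab [x]]].
    exists (ln (normc z), t) => //=; exists 1; first by rewrite /= in_itv/= lexx ler01.
    rewrite /f !mul1r lnK ?posrE ?normc_gt0// addrC subrK; exact/esym/is_argE.
  rewrite in_itv/= => /andP[x0 x1] <-.
  split.
    by rewrite mulf_neq0// -normc_gt0 ?normc_cis// normc_real normr_gt0 gt_eqF// expR_gt0.
  exists (m + x * (t - m)); last by apply: is_arg_polar; exact: expR_ge0.
  have [->|nx0] := eqVneq x 0; first by rewrite mul0r addr0.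
  have {}x0 : 0 < x by rewrite lt_neqAle eq_sym nx0.
  move/andP: am tab => [am mb] /andP[alt tbe].
  have h1 : 0 < x * (t - al) by rewrite mulr_gt0// subr_gt0.
  have h2 : 0 < x * (be - t) by rewrite mulr_gt0// subr_gt0.
  have h3 : 0 <= (1 - x) * (m - al) by rewrite mulr_ge0// subr_ge0// ltW.
  have h4 : 0 <= (1 - x) * (be - m) by rewrite mulr_ge0// subr_ge0// ltW.
  by apply/andP; split; lra.
apply: bigcup_connected.
  exists (cis m) => -[s t] /= _; exists 0; first by rewrite /= in_itv/= lexx ler01.
  by rewrite /f !mul0r addr0 expR0 mul1r.
move=> [s t] _; apply: connected_continuous_connected; first exact: segment_connected.
apply: continuous_subspaceT => x.
have cl : continuous (fun x : R => m + x * (t - m)).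
  by move=> y; apply: cvgD; [exact: cvg_cst|apply: cvgM; [exact: cvg_id|exact: cvg_cst]].
have ce : continuous (fun x : R => expR (x * s)).
  move=> y; apply: continuous_comp; last exact: continuous_expR.
  by apply: cvgM; [exact: cvg_id|exact: cvg_cst].
rewrite (_ : f s t = (fun x => ((expR (x * s) * cos (m + x * (t - m))) +i*
   (expR (x * s) * sin (m + x * (t - m))))%C)); last by apply/funext => y; exact: fE.
apply: cvg_ReIm => /=; apply: cvgM; try exact: ce.
  by apply: (continuous_comp (cl x)); exact: continuous_cos.
by apply: (continuous_comp (cl x)); exact: continuous_sin.
Qed.

End Arguments.

(** * Angles complementary to a closed system of rays *)

Section Components.
Context {R : realType}.
Implicit Types (S : set R[i]) (z : R[i]) (s t al be : R).

Lemma system_of_rays0 S : system_of_rays S -> S !=set0 -> S 0.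
Proof.
move=> [T ->] [z [t Tt _]]; exists t => //; exists 0; rewrite ?mul0r//.
Qed.

Lemma system_of_rays_cis S : system_of_rays S -> S !=set0 -> exists t, S (cis t).
Proof.
move=> [T ->] [z [t Tt _]]; exists t, t => //; exists 1 => //; by rewrite mul1r.
Qed.

Lemma system_of_rays_arg S z t : system_of_rays S -> z != 0 -> is_arg z t ->
  S z <-> S (cis t).
Proof.
move=> [T ->] z0 zt; have n0 : 0 < normc z by rewrite normc_gt0.
have nC0 : (normc z)%:C%C != 0 :> R[i] by rewrite -normc_gt0 normc_real normr_gt0 gt_eqF.
split=> -[s Ts [r r0 E]]; exists s => //.
  exists (r / normc z); first by rewrite divr_ge0// ltW.
  apply: (mulfI nC0); rewrite mulrA -rmorphM/= mulrCA mulfV ?gt_eqF// mulr1 -E.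
  exact/esym/is_argE.
exists (normc z * r); first by rewrite mulr_ge0// ltW.
by rewrite rmorphM -mulrA -E; exact/is_argE.
Qed.

(** [al] and [be] are the nearest arguments of rays of S on either side of an argument of z; they
    exist because S is closed and nonempty. The angle between them is connected and relatively open
    and closed in the complement of S, hence a component. *)
Lemma angle_complementary S z : system_of_rays S -> S !=set0 -> closed S -> ~ S z ->
  exists al be, complementary_angles S (al, be) /\
    angle al be = connected_component (~` S) z.
Proof.
move=> rS S0 cS Sz.
have S00 := system_of_rays0 rS S0.
have [t0 St0] := system_of_rays_cis rS S0.
have nz0 w : ~ S w -> w != 0 by apply: contra_notN => /eqP ->.
have z0 := nz0 _ Sz.
have [th zth] := is_arg_exists z.
have Sth : ~ S (cis th) by move/(system_of_rays_arg rS z0 zth).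
have cTh : closed [set t | S (cis t)].
  by apply: (@closed_comp _ _ (@cis R)) => // x _; exact: cis_continuous.
have [al [Sal alth] almax] : exists2 m, [set t | S (cis t)] m /\ m <= th &
    forall x, [set t | S (cis t)] x /\ x <= th -> x <= m.
  apply: (@closed_max _ ([set t | S (cis t)] `&` [set t | t <= th])).
  - by apply: closedI => //; exact: closed_le.
  - have [k /andP[_ kP]] := shift_window t0 (th - 2 * pi).
    by exists (t0 + 2 * pi * k%:~R); rewrite /= cis_periodz; split => //; lra.
  - by exists th => x [].
have [be [Sbe thbe] bemin] : exists2 m, [set t | S (cis t)] m /\ th <= m &
    forall x, [set t | S (cis t)] x /\ th <= x -> m <= x.
  apply: (@closed_min _ ([set t | S (cis t)] `&` [set t | th <= t])).
  - by apply: closedI => //; exact: closed_ge.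
  - have [k /andP[kP _]] := shift_window t0 th.
    by exists (t0 + 2 * pi * k%:~R); rewrite /= cis_periodz; split.
  - by exists th => x [].
rewrite /= in Sal Sbe.
have {}alth : al < th by rewrite lt_neqAle alth andbT; apply: contra_notN Sth => /eqP <-.
have {}thbe : th < be by rewrite lt_neqAle thbe andbT; apply: contra_notN Sth => /eqP ->.
have Sal2 : S (cis (al + 2 * pi)) by rewrite -[2 * pi]mulr1 -(cis_periodz al 1) in Sal *.
have p0 := @twopi_gt0 R.
(* al + 2 pi is also the argument of a ray of S, and it is not below th by maximality of [al]; so
   minimality of [be] applies to it. *)
have be2 : be <= al + 2 * pi.
  apply: bemin; split => //; rewrite leNgt; apply/negP => H.
  have : al + 2 * pi <= al by apply: almax; split => //; exact: ltW.
  lra.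
have gap t : al < t < be -> ~ S (cis t).
  move=> /andP[alt tbe] St; have [tth|tht] := leP t th.
    by have := almax _ (conj St tth); rewrite leNgt alt.
  by have := bemin _ (conj St (ltW tht)); rewrite leNgt tbe.
have sub : angle al be `<=` ~` S.
  by move=> w [w0 [t tab wt]] /(system_of_rays_arg rS w0 wt); exact: gap.
have zab : angle al be z by split=> //; exists th => //; rewrite alth.
have albe : al < be by lra.
(* Relative closedness: a point off S and outside the angle has an argument in ]be, al + 2 pi[, and
   the open angle so defined is disjoint from [angle al be]. *)
have clos w : closure (angle al be) w -> ~ S w -> angle al be w.
  move=> cw Sw; have w0 := nz0 _ Sw.
  have [t /andP[alt tal] wt] := is_arg_window w al.
  have Nt : ~ S (cis t) by move/(system_of_rays_arg rS w0 wt).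
  have {}alt : al < t by rewrite lt_neqAle alt andbT; apply: contra_notN Nt => /eqP <-.
  have [tbe|bet] := ltP t be; first by split => //; exists t => //; rewrite alt.
  have {}bet : be < t by rewrite lt_neqAle bet andbT; apply: contra_notN Nt => /eqP <-.
  have : nbhs w (angle be (al + 2 * pi)).
    apply: open_nbhs_nbhs; split; first exact: open_angle.
    by split => //; exists t => //; rewrite bet.
  move=> /cw[v [[v0 [s /andP[als sbe] vs]] [_ [s' /andP[bes' s'al] vs']]]].
  suff : s = s' by lra.
  by apply: is_arg_uniq vs vs' => //; rewrite ltr_norml; apply/andP; split; lra.
have comp : angle al be = connected_component (~` S) z.
  apply/seteqP; split.
    by apply: connected_component_max => //; exact: connected_angle.
  move=> w [C [Cz CS Cc] Cw].
  suff : C `&` angle al be = C by move=> CE; move: Cw; rewrite -CE => -[].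
  apply: Cc; first by exists z.
    by exists (angle al be) => //; exact: open_angle.
  exists (closure (angle al be)); first exact: closed_closure.
  apply/seteqP; split => v [Cv]; first by split => //; exact: subset_closure.
  by move=> cv; split => //; apply: clos => //; exact: CS.
(* A shift by a multiple of 2 pi reaches the normalization 0 <= al < 2 pi. *)
have [k /andP[k0 k2]] := shift_window al 0; rewrite add0r in k2.
exists (al + 2 * pi * k%:~R), (be + 2 * pi * k%:~R).
have angE : angle (al + 2 * pi * k%:~R) (be + 2 * pi * k%:~R) = angle al be.
  apply/seteqP; split => w [w0 [t tab wt]]; split => //.
    exists (t + 2 * pi * (- k)%:~R); last exact: is_arg_shift.
    by rewrite mulrNz mulrN; lra.
  by exists (t + 2 * pi * k%:~R); [lra|exact: is_arg_shift].
split; last by rewrite angE.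
split=> /=; [by rewrite k0 k2|by apply/andP; split; lra|by exists z; rewrite ?angE].
Qed.

(* Choosing a rational in each interval ]al, be[ is injective: two complementary
   angles meeting at an argument [r] are the same component. *)
Lemma countable_complementary_angles S : countable (complementary_angles S).
Proof.
have q_ex (ab : R * R) : exists q : rat, ab.1 < ab.2 -> ab.1 < ratr q < ab.2.
  have [/rat_in_itvoo[q]|] := ltP ab.1 ab.2; last by exists 0.
  by rewrite in_itv/= => H; exists q.
have [q qP] := choice q_ex.
apply/countable_injP; exists (fun ab => pickle (q ab)).
move=> [a b] [a' b'] /set_mem[/= _ /andP[ab b2] [z Sz zE]] /set_mem[/= _ /andP[ab' b2'] [z' Sz' zE']].
move=> /(pcan_inj (@pickleK rat)) qq.
have /= := qP (a, b); rewrite qq => /(_ ab) /andP[aq qb].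
have /= := qP (a', b') => /(_ ab') /andP[aq' qb'].
set r : R := ratr (q (a', b')) in aq qb aq' qb'.
have r0 s : cis s != 0 :> R[i] by rewrite -normc_gt0 normc_cis.
have rab : angle a b (cis r) by split=> //; exists r; [rewrite aq|exact: is_arg_cis].
have rab' : angle a' b' (cis r) by split=> //; exists r; [rewrite aq'|exact: is_arg_cis].
have EE : angle a b = angle a' b'.
  rewrite zE zE' in rab rab' *.
  by rewrite (same_connected_component rab) (same_connected_component rab').
have key (x c d : R) : angle c d (cis x) -> (c < d <= c + 2 * pi) ->
    (x = c \/ x = d) -> False.
  move=> [_ [t /andP[ct td] xt]] /andP[cd d2] xcd.
  suff : x = t by case: xcd => ->; lra.
  apply: (is_arg_uniq (r0 x) _ (is_arg_cis x) xt).
  by case: xcd => ->; rewrite ltr_norml; apply/andP; split; lra.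
have ang (c d x : R) : c < x < d -> angle c d (cis x).
  by move=> H; split=> //; exists x => //; exact: is_arg_cis.
have a_eq : a = a'.
  have [aa|aa|//] := ltgtP a a'; exfalso.
    apply: (@key a' a' b'); [rewrite -EE; apply: ang; lra|lra|by left].
  apply: (@key a a b); [rewrite EE; apply: ang; lra|lra|by left].
have b_eq : b = b'.
  have [aa|aa|//] := ltgtP b b'; exfalso.
    apply: (@key b a b); [rewrite EE; apply: ang; lra|lra|by right].
  apply: (@key b' a' b'); [rewrite -EE; apply: ang; lra|lra|by right].
by rewrite a_eq b_eq.
Qed.

End Components.

(** * The maximum principle *)

Section RawIntegral.
Local Open Scope ereal_scope.
Context d (T : measurableType d) (R : realType) (mu : {measure set T -> \bar R}).
Implicit Types (f g : T -> \bar R) (D : set T).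

(* The integral of a nonnegative function is a supremum over the simple functions
   below it, hence monotone on arbitrary functions. *)
Lemma ge0_le_integral_raw D f g : (forall x, D x -> 0 <= f x) ->
  (forall x, D x -> f x <= g x) ->
  \int[mu]_(x in D) f x <= \int[mu]_(x in D) g x.
Proof.
move=> f0 fg; have g0 x : D x -> 0 <= g x by move=> Dx; exact: le_trans (f0 _ Dx) (fg _ Dx).
rewrite !ge0_integralE//; apply: ereal_sup_le => _ [h hf <-]; exists h => // x.
by apply: (le_trans (hf x)); rewrite /patch; case: ifPn => // /set_mem; exact: fg.
Qed.

(** Meant for circle means, whose integrand may take the value -oo; positive and negative parts are
    compared separately, which requires no measurability. *)
Lemma le_integral_raw D f g : (forall x, D x -> f x <= g x) ->
  \int[mu]_(x in D) f x <= \int[mu]_(x in D) g x.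
Proof.
move=> fg; rewrite integralE [leRHS]integralE; apply: leeB.
  apply: ge0_le_integral_raw => x Dx; first exact: funepos_ge0.
  by rewrite !funeposE ge_max le_max fg//= le_max lexx orbT.
apply: ge0_le_integral_raw => x Dx; first exact: funeneg_ge0.
by rewrite !funenegE ge_max !le_max leeN2 fg//= lexx orbT.
Qed.

End RawIntegral.

Section CircleMean.
Context {R : realType}.
Implicit Types (k a b c d rho : R) (z : R[i]).

(** These are the functions of t obtained by restricting Im (c1 h + c2 h^2) and |z + h|^2 to the
    circle h = rho e^(it). The explicit primitive [G] shows that only the constant survives. *)
Lemma integral_trig_polynomial k a b c d :
  (\int[lebesgue_measure]_(t in `[0%R, (2 * pi)%R])
    (k + a * cos t + b * sin t + c * (cos t ^+ 2 - sin t ^+ 2) +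
     d * (2 * sin t * cos t))%:E = (2 * pi * k)%:E)%E.
Proof.
pose G t : R := k * t + a * sin t - b * cos t + c * (sin t * cos t) + d * sin t ^+ 2.
have dG (t : R) : is_derive t 1 G (k + a * cos t + b * sin t +
    c * (cos t ^+ 2 - sin t ^+ 2) + d * (2 * sin t * cos t)).
  apply: is_derive_eq; rewrite -![_ *: _]/(_ * _); ring.
have cG : continuous G.
  by move=> t; apply/differentiable_continuous/derivable1_diffP; case: (dG t).
rewrite (@continuous_FTC2 _ _ G).
- rewrite /G mulrC -EFinB.
  have -> : 2 * pi = pi *+ 2 :> R by rewrite mulr_natl.
  by rewrite sin2pi cos2pi sin0 cos0; congr EFin; ring.
- exact: twopi_gt0.
- apply: continuous_subspaceT => t.
  have cs := @continuous_sin R t; have cc := @continuous_cos R t.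
  apply: cvgD; [apply: cvgD; [apply: cvgD; [apply: cvgD|]|]|]; try exact: cvg_cst.
  + by apply: cvgM; [exact: cvg_cst|].
  + by apply: cvgM; [exact: cvg_cst|].
  + apply: cvgM; first exact: cvg_cst.
    by apply: cvgB; [exact: (cvgM cc cc)|exact: (cvgM cs cs)].
  + apply: cvgM; first exact: cvg_cst.
    by apply: cvgM => //; apply: cvgM => //; exact: cvg_cst.
- split; first by move=> t _; case: (dG t).
    by apply: cvg_at_right_filter; exact: cG.
  by apply: cvg_at_left_filter; exact: cG.
- by move=> t _; rewrite derive1E; have := dG t => ?; rewrite derive_val.
Qed.

Lemma circle_mean_le (u : R[i] -> \bar R) z rho k a b c d :
  (forall t, (u (z + rho%:C%C * cis t)%R <= (k + a * cos t + b * sin t +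
     c * (cos t ^+ 2 - sin t ^+ 2) + d * (2 * sin t * cos t))%:E)%E) ->
  (circle_mean u z rho <= k%:E)%E.
Proof.
move=> uk; have p0 := @twopi_gt0 R.
have -> : k%:E = ((2 * pi)^-1%:E * (2 * pi * k)%:E)%E.
  by rewrite -EFinM mulrA mulVf ?mul1r// gt_eqF.
rewrite /circle_mean lee_pmul2l//; last by rewrite lte_fin invr_gt0.
rewrite -(integral_trig_polynomial k a b c d).
by apply: le_integral_raw => t _; exact: uk.
Qed.

End CircleMean.

Section MaximumPrinciple.
Context {R : realType}.
Implicit Types (D : set R[i]) (V : R[i] -> R) (u : R[i] -> \bar R) (z w h : R[i]).

(* The quadratic polynomial Im (c1 h + c2 h^2) is harmonic, hence has mean zero
   on every circle centred at 0. *)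
Definition harmonic_jet V z := exists c1 c2 : R[i], forall e, 0 < e ->
  \forall h \near (0 : R[i]),
    `|V (z + h) - (V z + complex.Im (c1 * h + c2 * h ^+ 2))| <= e * normc h ^+ 2.

Lemma harmonic_jet_continuous V z : harmonic_jet V z -> {for z, continuous V}.
Proof.
move=> [c1 [c2 Vz]]; apply: continuous_normcP => e e0.
have n1 := normc_ge0 c1; have n2 := normc_ge0 c2.
pose M := normc c1 + normc c2 + 1.
have M0 : 0 < M by rewrite /M; lra.
suff /nbhs0_normcP[d d0 dP] : \forall h \near (0 : R[i]), `|V (z + h) - V z| < e.
  by exists d => // w /dP; rewrite [z + _]addrC subrK.
near=> h.
have h1 : normc h < 1 by near: h; exact: near0_normc.
have hM : normc h < e / M by near: h; apply: near0_normc; exact: divr_gt0.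
have h0 := normc_ge0 h.
have H : `|V (z + h) - (V z + complex.Im (c1 * h + c2 * h ^+ 2))| <= 1 * normc h ^+ 2.
  by near: h; exact: Vz.
have -> : V (z + h) - V z = (V (z + h) - (V z + complex.Im (c1 * h + c2 * h ^+ 2))) +
  complex.Im (c1 * h + c2 * h ^+ 2) by ring.
apply: (le_lt_trans (ler_normD _ _)).
have I1 := Im_le_normc (c1 * h + c2 * h ^+ 2).
have I2 := le_normcD (c1 * h) (c2 * h ^+ 2).
rewrite (normcM c1) (normcM c2) normcX in I2.
have h2 : normc h ^+ 2 <= normc h by rewrite expr2; nra.
have h3 := ler_wpM2l n2 h2.
have : M * normc h < e by rewrite mulrC -ltr_pdivlMr.
rewrite /M; lra.
Unshelve. all: by end_near. Qed.

Lemma limf_esup_lt (T : choiceType) (X : filteredType T) (f : X -> \bar R)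
    (F : set_system X) (x : \bar R) :
  (limf_esup f F < x)%E -> exists2 A, F A & forall y, A y -> (f y < x)%E.
Proof.
move=> /ereal_inf_lt[_ [A FA <-] Ax]; exists A => // y Ay.
by apply: le_lt_trans Ax; apply: ereal_sup_ubound; exists y.
Qed.

Lemma ereal_lt_fin_between (x y : \bar R) : (x < y)%E ->
  exists r : R, (x < r%:E)%E /\ (r%:E < y)%E.
Proof.
case: x y => [x| |] [y| |] //=.
- by rewrite lte_fin => xy; exists ((x + y) / 2); rewrite !lte_fin; split; lra.
- by move=> _; exists (x + 1); rewrite lte_fin ltry; split => //; lra.
- by move=> _; exists (y - 1); rewrite lte_fin ltNyr; split => //; lra.
- by move=> _; exists 0; rewrite ltry ltNyr.
Qed.

Lemma normc_sqrD z h :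
  normc (z + h) ^+ 2 = normc z ^+ 2 + 2 * (complex.Re z * complex.Re h +
    complex.Im z * complex.Im h) + normc h ^+ 2.
Proof. by rewrite !normc_sqr; case: z h => [a b] [c d] /=; ring. Qed.

Lemma Im_jet_polar (c1 c2 : R[i]) rho t :
  complex.Im (c1 * (rho%:C%C * cis t) + c2 * (rho%:C%C * cis t) ^+ 2) =
  rho * (complex.Im c1 * cos t + complex.Re c1 * sin t) +
  rho ^+ 2 * (complex.Im c2 * (cos t ^+ 2 - sin t ^+ 2) +
              complex.Re c2 * (2 * sin t * cos t)).
Proof. by rewrite (expr2 (_ * _)); case: c1 c2 => [a b] [c d] /=; ring. Qed.

Lemma continuous_sqrM_sub (T : topologicalType) (f g : T -> R) (r : R) (x : T) :
  {for x, continuous f} -> {for x, continuous g} ->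
  {for x, continuous (fun y => r * f y ^+ 2 - g y)}.
Proof.
move=> cf cg; apply: cvgB => //; apply: cvgM; first exact: cvg_cst.
exact: (cvgM cf cf).
Qed.

Lemma lteD_fin (x : \bar R) (r s : R) :
  (x < r%:E)%E -> (x + s%:E < (r + s)%:E)%E.
Proof. by case: x => [x| |] //=; rewrite ?ltNyr// !lte_fin ltrD2r. Qed.

(* At a local maximum [z] of [u - V + eps |.|^2] the Taylor expansion bounds
   the circle means of [u] by [u z - eps rho^2 / 2], which contradicts
   subharmonicity. *)
Lemma no_strict_local_max u V z m eps : 0 < eps -> harmonic_jet V z ->
  (\forall rho \near (0 : R)^'+, u z <= circle_mean u z rho)%E ->
  u z = (m + V z - eps * normc z ^+ 2)%:E ->
  ~ (\forall h \near (0 : R[i])%R,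
      u (z + h)%R <= (m + V (z + h) - eps * normc (z + h) ^+ 2)%:E)%E.
Proof.
move=> eps0 [c1 [c2 Vz]] sub uz umax.
have e2 : 0 < eps / 2 by exact: divr_gt0.
have : \forall h \near (0 : R[i])%R, (u (z + h)%R <=
    (m + (V z + complex.Im (c1 * h + c2 * h ^+ 2) + eps / 2 * normc h ^+ 2)
     - eps * normc (z + h) ^+ 2)%:E)%E.
  have H1 := Vz _ e2.
  near=> h.
  have : `|V (z + h) - (V z + complex.Im (c1 * h + c2 * h ^+ 2))| <=
    eps / 2 * normc h ^+ 2 by near: h.
  rewrite ler_norml => /andP[_ H].
  apply: le_trans (_ : u (z + h)%R <= (m + V (z + h) - eps * normc (z + h) ^+ 2)%:E)%E _.
    by near: h.
  rewrite lee_fin; lra.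
move=> /nbhs0_normcP[d d0 dP].
have : \forall rho \near (0 : R)^'+, False; last first.
  by move=> /filter_ex[].
near=> rho.
have r0 : 0 < rho by near: rho; exact: nbhs_right_gt.
have rd : rho < d by near: rho; exact: nbhs_right_lt.
have : (u z <= circle_mean u z rho)%E by near: rho.
apply/negP; rewrite -ltNge.
set X := m + V z - eps * normc z ^+ 2 - eps / 2 * rho ^+ 2.
apply: (@le_lt_trans _ _ X%:E); last first.
  by rewrite uz lte_fin /X ltrBlDr ltrDl mulr_gt0// exprn_gt0.
apply: (@circle_mean_le _ u z rho X
  (rho * complex.Im c1 - 2 * eps * rho * complex.Re z)
  (rho * complex.Re c1 - 2 * eps * rho * complex.Im z)
  (rho ^+ 2 * complex.Im c2) (rho ^+ 2 * complex.Re c2)) => t.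
have nr : normc (rho%:C%C * cis t) = rho.
  by rewrite normcM normc_cis mulr1 normc_real gtr0_norm.
have := dP (rho%:C%C * cis t); rewrite nr => /(_ rd).
rewrite normc_sqrD nr => /le_trans; apply; rewrite lee_fin.
rewrite le_eqVlt; apply/orP; left; apply/eqP; rewrite /X Im_jet_polar /=; field.
Unshelve. all: by end_near. Qed.

(** Suppose u z0 exceeds V z0 by [eta]. Far away u < eta / 2 and V >= 0, so only a bounded part of D
    matters, on which f = u - V + eps |.|^2 has supremum at least [eta]. A cluster point of
    near-maximizers is not on the boundary, by the boundary inequalities; upper semicontinuity makes
    it a maximizer, against [no_strict_local_max]. *)
Lemma perron_family_le D (phi : R[i] -> R) V u : open D ->
  (forall z, D z -> harmonic_jet V z) ->
  (forall zeta, boundary D zeta -> forall e, 0 < e ->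
     \forall w \near zeta, D w -> phi zeta - e < V w) ->
  (forall z, D z -> 0 <= V z) ->
  perron_family D phi u -> forall z, D z -> (u z <= (V z)%:E)%E.
Proof.
move=> oD Vh Vb V0 [[ulty uusc umean] ub uinf] z0 Dz0.
rewrite leNgt; apply/negP => Vu.
have [u0 u0E] : exists u0 : R, u z0 = u0%:E.
  have := ulty _ Dz0; move: Vu; case: (u z0) => [r _ _|//|//]; by exists r.
rewrite u0E lte_fin in Vu.
pose eta := u0 - V z0.
have eta0 : 0 < eta by rewrite /eta subr_gt0.
have [M0 M0P] : exists M : R, forall w, D w -> M < normc w -> (u w < (eta / 2)%:E)%E.
  have [|A [M _ MA] AP] := @limf_esup_lt _ _ u (within D at_infinity) (eta / 2)%:E.
    by apply: le_lt_trans uinf _; rewrite lte_fin divr_gt0.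
  exists M => w Dw Mw; apply: AP; apply: MA => //=.
  by rewrite norm_complexE ltcR.
pose M := Num.max M0 (normc z0).
have MM0 : M0 <= M by rewrite le_max lexx.
have Mz0 : normc z0 <= M by rewrite le_max lexx orbT.
have M_ge0 : 0 <= M := le_trans (normc_ge0 z0) Mz0.
(* This makes eps |w|^2 at most eta / 4 on the disc of radius M + 1. The extra unit leaves room for
   a neighbourhood of a maximizer of modulus exactly M. *)
pose eps := eta / (4 * (M + 1) ^+ 2).
have M1 : 0 < (M + 1) ^+ 2 by rewrite exprn_gt0// ltr_wpDl.
have eps0 : 0 < eps by rewrite divr_gt0// mulr_gt0.
have epsM w : normc w <= M + 1 -> eps * normc w ^+ 2 <= eta / 4.
  move=> wM; have -> : eta / 4 = eps * (M + 1) ^+ 2 by rewrite /eps; field; rewrite gt_eqF// ltr_wpDl.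
  by rewrite ler_pM2l// ler_sqr ?nnegrE ?normc_ge0// addr_ge0.
pose p w : R := eps * normc w ^+ 2 - V w.
pose f w : \bar R := (u w + (p w)%:E)%E.
have fE w : f w = (u w + (p w)%:E)%E by [].
pose K := D `&` closed_disc M.
pose s := ereal_sup (f @` K).
have KP w : K w -> D w /\ normc w <= M by rewrite /K closed_discE.
have Kz0 : K z0 by rewrite /K closed_discE.
have etas : (eta%:E <= s)%E.
  apply: (@le_trans _ _ (f z0)); last by apply: ereal_sup_ubound; exists z0.
  rewrite /f u0E -EFinD lee_fin /p /eta.
  have : 0 <= eps * normc z0 ^+ 2 by rewrite mulr_ge0 ?exprn_ge0 ?normc_ge0// ltW.
  lra.
(* The superlevel sets of f below its supremum form a filter, whose cluster points replace the
   limits of a maximizing sequence. *)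
pose F : set_system R[i] := filter_from [set b : R | (b%:E < s)%E]
  (fun b => [set w | K w /\ (b%:E < f w)%E]).
have FF : ProperFilter F.
  apply: filter_from_proper; last first.
    by move=> b /ereal_sup_gt[_ [w Kw <-] bw]; exists w.
  apply: filter_from_filter.
    by exists 0 => /=; apply: lt_le_trans etas; rewrite lte_fin.
  move=> b c bs cs; exists (Num.max b c).
    by rewrite /= EFin_max gt_max bs cs.
  by move=> w [Kw]; rewrite EFin_max gt_max => /andP[].
have [z1 [z1M clz1]] : closed_disc M `&` cluster F !=set0.
  apply: compact_closed_disc; exists 0.
    by apply: lt_le_trans etas; rewrite lte_fin.
  by move=> w [[]].
have z1M' : normc z1 <= M by move: z1M; rewrite closed_discE.
have Dz1 : D z1.
  apply: contrapT => nDz1.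
  have bz1 : boundary D z1.
    split; last by move/interior_subset.
    move=> B Bz1; have [|w [[[Dw _] _] Bw]] := clz1 [set w | K w /\ (0%:E < f w)%E] B _ Bz1.
      by exists 0 => //=; apply: lt_le_trans etas; rewrite lte_fin.
    by exists w.
  (* Near a boundary point f < (phi + eta / 8) + eta / 4 - (phi - eta / 8) = eta / 2, whereas f > 3
     eta / 4 on a set of the filter. *)
  have e8 : 0 < eta / 8 by exact: divr_gt0.
  have [|A Az1 AP] := @limf_esup_lt _ _ u (within D (nbhs z1)) (phi z1 + eta / 8)%:E.
    by apply: le_lt_trans (ub _ bz1) _; rewrite lte_fin ltrDl.
  have Bz1 := Vb _ bz1 _ e8.
  have AB := @filterI _ _ (nbhs_filter z1) _ _ (Az1 : nbhs z1 [set w | D w -> A w]) Bz1.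
  have [|w] := clz1 [set w | K w /\ ((3 / 4 * eta)%:E < f w)%E] _ _ AB.
    exists (3 / 4 * eta) => //=; apply: lt_le_trans etas; rewrite lte_fin; lra.
  move=> [[/KP[Dw wM] fw] [/= Aw Bw]].
  have {}Aw := AP _ (Aw Dw); have {}Bw := Bw Dw.
  have wM1 : normc w <= M + 1 by lra.
  have := epsM _ wM1.
  have : (f w < (phi z1 + eta / 8 + p w)%:E)%E by exact: lteD_fin.
  move=> /(lt_trans fw); rewrite lte_fin /p; lra.
have Vcont := harmonic_jet_continuous (Vh _ Dz1).
have pcont : {for z1, continuous p}.
  exact: continuous_sqrM_sub (@normc_continuous R z1) Vcont.
have fz1 : (s <= f z1)%E.
  rewrite leNgt; apply/negP => /ereal_lt_fin_between[b [fb bs]].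
  have [b' [ub' b'b]] : exists b', (u z1 < b'%:E)%E /\ b' + p z1 < b.
    have : (u z1 < (b - p z1)%:E)%E by rewrite EFinB lteBrDr.
    move=> /ereal_lt_fin_between[b' [H1 H2]]; exists b'; split => //.
    by move: H2; rewrite lte_fin; lra.
  have U1 := uusc _ _ Dz1 ub'.
  have U2 : \forall w \near z1, p w < b - b'.
    by apply: (cvgr_lt _ pcont); lra.
  have U12 := @filterI _ _ (nbhs_filter z1) _ _ U1 U2.
  have [|w [[_ bw] [/= w1 w2]]] := clz1 [set w | K w /\ (b%:E < f w)%E] _ _ U12.
    by exists b.
  have : (f w < (b' + (b - b'))%:E)%E by rewrite EFinD; apply: lteD; rewrite ?lte_fin.
  by rewrite addrC subrK => /(lt_trans bw); rewrite ltxx.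
have Kz1 : K z1 by rewrite /K closed_discE.
have fs : f z1 = s.
  by apply/eqP; rewrite eq_le fz1 andbT; apply: ereal_sup_ubound; exists z1.
have [m mE] : exists m : R, s = m%:E.
  have : (s < +oo)%E by rewrite -fs fE lte_add_pinfty ?ltry// ulty.
  by move: etas; case: (s) => [r _ _|//|//]; exists r.
have etam : eta <= m by move: etas; rewrite mE lee_fin.
apply: (@no_strict_local_max u V z1 m eps eps0 (Vh _ Dz1) (umean _ Dz1)).
  move: fs; rewrite mE /f /p; case: (u z1) => [r| |] //= [<-]; congr EFin; ring.
have : nbhs z1 [set w | D w /\ normc w < M + 1].
  apply: filterI; first by apply: open_nbhs_nbhs.
  apply: (cvgr_lt _ (@normc_continuous R z1)); lra.
move=> /nbhs_normcP[d d0 dP]; apply/nbhs0_normcP; exists d => // h hd.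
have [Dw wM] : D (z1 + h) /\ normc (z1 + h) < M + 1.
  by apply: dP; rewrite addrC addKr.
set w := z1 + h in Dw wM *.
suff : (f w <= m%:E)%E.
  by rewrite fE -leeBrDr// -EFinB /p; congr (_ <= _%:E)%E; ring.
have [wM1|wM1] := leP (normc w) M.
  by rewrite -mE; apply: ereal_sup_ubound; exists w => //; rewrite /K closed_discE.
(* Between the radii M and M + 1 the bound u < eta / 2 gives f < 3 eta / 4, which is below m. *)
apply: ltW; apply: (@lt_le_trans _ _ (eta / 2 + p w)%:E).
  by apply: lteD_fin; apply: M0P => //; exact: le_lt_trans wM1.
rewrite lee_fin /p; have := epsM _ (ltW wM); have := V0 _ Dw; lra.
Qed.

End MaximumPrinciple.

(** * Harmonic measure of a segment in an angle *)

Section TrigBounds.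
Context {R : realType}.
Implicit Types (x : R).

Lemma sin_le x : 0 <= x -> sin x <= x.
Proof.
move=> x0; have [c _] := MVT_abs x (fun y => is_derive_sin y).
rewrite sin0 subr0 => ->; apply: ler_piMl => //; exact: cos_le1.
Qed.

Lemma atan_le x : 0 <= x -> atan x <= x.
Proof.
move=> x0; have [c _] := MVT_abs x (fun y => is_derive1_atan y).
rewrite atan0 subr0 => ->; apply: ler_piMl => //.
by rewrite invf_le1 ?lerDl ?sqr_ge0// ltr_wpDr ?sqr_ge0.
Qed.

Lemma pihalf_sub_atan x : 0 < x -> pi / 2 - atan x = atan x^-1.
Proof.
move=> x0.
have a0 : 0 < atan x by rewrite -(@atan0 R); exact: lt_atan.
have a1 := atan_ltpi2 x.
rewrite -[LHS]tanK; last by rewrite in_itv/=; apply/andP; split; lra.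
congr atan; rewrite {1}/tan addrC sinDpihalf cosDpihalf sinN cosN opprK.
have -> : x^-1 = (tan (atan x))^-1 by rewrite atanK.
by rewrite /tan invf_div.
Qed.

Lemma pihalf_sub_atan_le x : 0 < x -> pi / 2 - atan x <= x^-1.
Proof. by move=> x0; rewrite pihalf_sub_atan// atan_le// invr_ge0 ltW. Qed.

End TrigBounds.

(** * The kernel of the upper half-plane *)

Section HalfPlaneKernel.
Context {R : realType}.
Implicit Types (w : R[i]) (t x y : R).

(** The arccotangent of Re w / Im w: a single formula for the argument over the whole upper
    half-plane, with values in ]0, pi[ for every w. *)
Definition uarg w : R := pi / 2 - atan (complex.Re w / complex.Im w).

Lemma is_arg_uarg w : 0 < complex.Im w -> is_arg w (uarg w).
Proof.
move=> w0.
have wE : w = (complex.Im w +i* - complex.Re w)%C * 'i%C.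
  by case: w w0 => x y _; apply/eqP; rewrite eq_complex /=; apply/andP; split; apply/eqP; ring.
have iE : is_arg ('i%C : R[i]) (pi / 2).
  by rewrite is_argE /cis cos_pihalf sin_pihalf/= expr0n/= add0r expr1n sqrtr1 mul1r.
have H : is_arg (complex.Im w +i* - complex.Re w)%C (- atan (complex.Re w / complex.Im w)).
  by rewrite is_argE {1}(@polar_Re_gt0 _ (_ +i* _)%C)//= mulNr atanN.
by rewrite {1}wE /uarg addrC; exact: is_argM.
Qed.

Lemma uarg_gt0 w : 0 < uarg w.
Proof. by rewrite subr_gt0 atan_ltpi2. Qed.

Lemma uarg_ltpi w : uarg w < pi.
Proof. by rewrite /uarg; have := atan_gtNpi2 (complex.Re w / complex.Im w); lra. Qed.

(* Its argument is the angle under which the segment [-t, t] is seen from [w]. *)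
Definition segment_quotient t w : R[i] :=
  ((normc w ^+ 2 - t ^+ 2) +i* (2 * t * complex.Im w))%C.

(* Harmonic measure of [-t, t] for the upper half-plane. *)
Definition half_plane_measure t w : R := uarg (segment_quotient t w) / pi.

Lemma segment_quotientE t w :
  segment_quotient t w = (w - t%:C%C) * conjc (w + t%:C%C).
Proof.
rewrite /segment_quotient normc_sqr; case: w => x y.
by apply/eqP; rewrite eq_complex /=; apply/andP; split; apply/eqP; ring.
Qed.

Lemma half_plane_measure_ge0 t w : 0 <= half_plane_measure t w.
Proof. by rewrite divr_ge0 ?pi_ge0// ltW// uarg_gt0. Qed.

Lemma half_plane_measure_le1 t w : half_plane_measure t w <= 1.
Proof. by rewrite ler_pdivrMr ?pi_gt0// mul1r ltW// uarg_ltpi. Qed.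

Lemma mul2_pi_cancel t x y : 2 / pi * t * x * y * pi = 2 * t * x * y.
Proof.
have : pi != 0 :> R by rewrite gt_eqF// pi_gt0.
by generalize (pi : R) => p p0; field.
Qed.

Lemma half_plane_measure_le t w : 0 < t < normc w -> 0 < complex.Im w ->
  half_plane_measure t w <= 2 / pi * t * complex.Im w / (normc w - t) ^+ 2.
Proof.
move=> /andP[t0 tw] w0.
have n0 : 0 < normc w by exact: lt_trans tw.
have s0 : 0 < normc w ^+ 2 - t ^+ 2 by rewrite subr_gt0 ltr_sqr ?nnegrE// ltW.
have x0 : 0 < (normc w ^+ 2 - t ^+ 2) / (2 * t * complex.Im w).
  by rewrite divr_gt0 ?mulr_gt0.
have d0 : 0 < normc w - t by rewrite subr_gt0.
rewrite /half_plane_measure /uarg /= ler_pdivrMr ?pi_gt0//.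
apply: (le_trans (pihalf_sub_atan_le x0)); rewrite invf_div.
rewrite mul2_pi_cancel.
apply: ler_wpM2l; first by rewrite ltW// !mulr_gt0.
rewrite lef_pV2 ?posrE ?exprn_gt0//; rewrite !expr2; nra.
Qed.

(** For |w| < t the segment is seen under an obtuse angle, and the tangent bounds its supplement.
    This yields boundary values 1 inside ]-t, t[. *)
Lemma half_plane_measure_ge t w : 0 < t -> normc w < t -> 0 < complex.Im w ->
  1 - 2 / pi * t * complex.Im w / (t ^+ 2 - normc w ^+ 2) <= half_plane_measure t w.
Proof.
move=> t0 tw w0.
have d0 : 0 < t ^+ 2 - normc w ^+ 2 by rewrite subr_gt0 ltr_sqr ?nnegrE ?normc_ge0// ltW.
have x0 : 0 < (t ^+ 2 - normc w ^+ 2) / (2 * t * complex.Im w).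
  by rewrite divr_gt0 ?mulr_gt0.
have := pihalf_sub_atan_le x0; rewrite invf_div => H.
rewrite /half_plane_measure /uarg /= ler_pdivlMr ?pi_gt0//.
have -> : (normc w ^+ 2 - t ^+ 2) / (2 * t * complex.Im w) =
  - ((t ^+ 2 - normc w ^+ 2) / (2 * t * complex.Im w)) by rewrite -[in RHS]mulNr opprB.
rewrite atanN opprK mulrBl mul1r.
rewrite mul2_pi_cancel.
lra.
Qed.

Lemma is_arg_conjc w t : is_arg w t -> is_arg (conjc w) (- t).
Proof.
rewrite !is_argE => wE.
have -> : normc (conjc w) = normc w by case: (w) => x y /=; rewrite sqrrN.
rewrite {1}wE rmorphM /= oppr0 /cis cosN sinN.
by apply/eqP; rewrite eq_complex /= !eqxx.
Qed.

Lemma ImB (v w : R[i]) : complex.Im (v - w) = complex.Im v - complex.Im w.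
Proof. exact: raddfB. Qed.

Lemma near_is_arg1D (f : R[i] -> R[i]) : f @ (0 : R[i]) --> (0 : R[i]) ->
  \forall h \near (0 : R[i]), is_arg (1 + f h) (complex.Im (clog1 (f h))).
Proof.
move=> f0; have H := near_comp0 f0 (@near0_Re1D R).
near=> h; rewrite -clog1K; first exact: cexp_is_arg.
by near: h.
Unshelve. all: by end_near. Qed.

(* [uarg (segment_quotient t w)] is, up to a constant, the imaginary part of
   [log (w - t) - log (w + t)]. *)
Lemma harmonic_jet_half_plane_measure (Z : R[i] -> R[i]) (z : R[i]) (q : R[i] -> R[i]) t :
  0 < t -> 0 < complex.Im (Z z) -> jet2 q ->
  (\forall h \near (0 : R[i]), 0 < complex.Im (Z (z + h)) /\
     Z (z + h) = Z z * (1 + q h)) ->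
  harmonic_jet (fun z => half_plane_measure t (Z z)) z.
Proof.
move=> t0 Zz jq Zh.
set w := Z z in Zz Zh *.
have wm0 : w - t%:C%C != 0.
  by apply: contraTneq Zz => /eqP; rewrite subr_eq0 => /eqP ->; rewrite ltxx.
have wp0 : w + t%:C%C != 0.
  by apply: contraTneq Zz => /eqP; rewrite addr_eq0 => /eqP ->; rewrite /= oppr0 ltxx.
(* Chosen so that w (1 + q) - t = (w - t) (1 + k1 q) and w (1 + q) + t = (w + t) (1 + k2 q). *)
pose k1 := w / (w - t%:C%C); pose k2 := w / (w + t%:C%C).
pose f1 h := clog1 (k1 * q h); pose f2 h := clog1 (k2 * q h).
have j1 : jet2 (fun h => k1 * q h) := jet2_comp (jet2_mull k1) jq.
have j2 : jet2 (fun h => k2 * q h) := jet2_comp (jet2_mull k2) jq.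
have jf1 : jet2 f1 := jet2_comp (@jet2_clog1 R) j1.
have jf2 : jet2 f2 := jet2_comp (@jet2_clog1 R) j2.
have jF := jet2B jf1 jf2.
have F0 := jet2_cvg0 jF.
have A1 := near_is_arg1D (jet2_cvg0 j1).
have A2 := near_is_arg1D (jet2_cvg0 j2).
set th := uarg (segment_quotient t w).
have th0 : 0 < th := uarg_gt0 _. have thpi : th < pi := uarg_ltpi _.
(* This keeps th + Im (f1 h - f2 h) inside ]0, pi[, so that it is the value of [uarg] and not
   another argument modulo 2 pi. *)
pose e1 := Num.min th (pi - th).
have e10 : 0 < e1 by rewrite lt_min th0 subr_gt0.
have /cvg0_normcP/(_ _ e10) Fe := F0.
have E : \forall h \near (0 : R[i]),
    uarg (segment_quotient t (Z (z + h))) = th + complex.Im (f1 h - f2 h).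
  near=> h.
  have [Ih Zhh] : 0 < complex.Im (Z (z + h)) /\ Z (z + h) = w * (1 + q h) by near: h.
  have B1 : is_arg (1 + k1 * q h) (complex.Im (f1 h)) by rewrite /f1; near: h.
  have B2 : is_arg (1 + k2 * q h) (complex.Im (f2 h)) by rewrite /f2; near: h.
  have B3 : normc (f1 h - f2 h) < e1 by near: h.
  have := le_lt_trans (Im_le_normc _) B3.
  rewrite lt_min !ltr_norml => /andP[/andP[H3 _] /andP[_ H4]].
  have Iw : 0 < complex.Im (segment_quotient t w) by rewrite /= !mulr_gt0.
  have IZ : 0 < complex.Im (segment_quotient t (Z (z + h))) by rewrite /= !mulr_gt0.
  have ZE : segment_quotient t (Z (z + h)) =
      segment_quotient t w * ((1 + k1 * q h) * conjc (1 + k2 * q h)).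
    have M1 : Z (z + h) - t%:C%C = (w - t%:C%C) * (1 + k1 * q h).
      by rewrite Zhh /k1; field.
    have M2 : Z (z + h) + t%:C%C = (w + t%:C%C) * (1 + k2 * q h).
      by rewrite Zhh /k2; field.
    by rewrite !segment_quotientE M1 M2 rmorphM /=; ring.
  apply: (@is_arg_uniq _ (segment_quotient t (Z (z + h)))).
  - by apply: contraTneq IZ => ->; rewrite ltxx.
  - have u0 := uarg_gt0 (segment_quotient t (Z (z + h))).
    have u1 := uarg_ltpi (segment_quotient t (Z (z + h))).
    by rewrite ltr_norml; apply/andP; split; lra.
  - exact: is_arg_uarg.
  - rewrite ZE raddfB /=; apply: is_argM; first exact: is_arg_uarg.
    by apply: is_argM => //; exact: is_arg_conjc.
case: jF => [c1 [c2 FP]].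
exists ((pi^-1)%:C%C * c1), ((pi^-1)%:C%C * c2) => e e0.
have pi0 := pi_gt0 R.
have epi : 0 < e * pi by rewrite mulr_gt0.
have FPe := FP _ epi.
near=> h.
have Eh : uarg (segment_quotient t (Z (z + h))) = th + complex.Im (f1 h - f2 h) by near: h.
have Fh : normc (f1 h - f2 h - (c1 * h + c2 * h ^+ 2)) <= e * pi * normc h ^+ 2 by near: h.
rewrite /half_plane_measure Eh -/w -/th.
have -> : complex.Im ((pi^-1)%:C%C * c1 * h + (pi^-1)%:C%C * c2 * h ^+ 2) =
    complex.Im (c1 * h + c2 * h ^+ 2) / pi.
  rewrite -!mulrA -mulrDr; case: (_ + _) => x y /=; ring.
have -> : (th + complex.Im (f1 h - f2 h)) / pi - (th / pi + complex.Im (c1 * h + c2 * h ^+ 2) / pi)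
    = complex.Im (f1 h - f2 h - (c1 * h + c2 * h ^+ 2)) / pi.
  by rewrite (ImB (f1 h - f2 h)); ring.
rewrite normrM (gtr0_norm (_ : 0 < pi^-1)) ?invr_gt0// ler_pdivrMr//.
by apply: (le_trans (Im_le_normc _)); rewrite mulrAC.
Unshelve. all: by end_near. Qed.

End HalfPlaneKernel.

Section AngleMeasure.
Context {R : realType}.
Implicit Types (z w : R[i]) (al be r t : R) (B : set R[i]).
Local Notation pow al be := (pi / (be - al)).

Lemma pow_gt0 al be : al < be -> 0 < pow al be :> R.
Proof. by move=> ab; rewrite divr_gt0 ?pi_gt0// subr_gt0. Qed.

Lemma pow_ge_half al be : al < be <= al + 2 * pi -> 2^-1 <= pow al be :> R.
Proof.
move=> /andP[ab ab2]; rewrite ler_pdivlMr ?subr_gt0//; lra.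
Qed.

Lemma normc_angle_map al be z : al < be <= al + 2 * pi -> angle al be z ->
  normc (angle_map al be z) = normc z `^ pow al be.
Proof.
move=> ab [z0 [s sab zs]]; rewrite (angle_mapE ab z0 sab zs) normcM normc_cis mulr1.
by rewrite normc_real ger0_norm// powR_ge0.
Qed.

Lemma Im_angle_map al be z s : al < be <= al + 2 * pi -> z != 0 ->
  al < s < be -> is_arg z s ->
  complex.Im (angle_map al be z) = normc z `^ pow al be * sin (pow al be * (s - al)).
Proof.
move=> ab z0 sab zs; rewrite (angle_mapE ab z0 sab zs) /= mul0r addr0 //.
Qed.

Lemma Im_angle_map_gt0 al be z : al < be <= al + 2 * pi -> angle al be z ->
  0 < complex.Im (angle_map al be z).
Proof.
move=> ab [z0 [s sab zs]]; rewrite (Im_angle_map ab z0 sab zs).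
move/andP: ab sab => [ab _] /andP[als sbe].
have p0 := pow_gt0 ab.
rewrite mulr_gt0 ?powR_gt0 ?normc_gt0//; apply: sin_gt0_pi.
rewrite mulr_gt0 ?subr_gt0//=.
have -> : pow al be * (s - al) = pi * ((s - al) / (be - al)) by ring.
rewrite gtr_pMr ?pi_gt0// ltr_pdivrMr ?subr_gt0// mul1r; lra.
Qed.

Definition angle_measure al be t z : R :=
  half_plane_measure t (angle_map al be z).

Lemma harmonic_jet_angle_measure al be t z : al < be <= al + 2 * pi -> 0 < t ->
  angle al be z -> harmonic_jet (angle_measure al be t) z.
Proof.
move=> ab t0 zab; have [q jq qE] := angle_map_jet ab zab.
apply: (harmonic_jet_half_plane_measure t0 _ jq); first exact: Im_angle_map_gt0.
near=> h.
have [H1 H2] : angle al be (z + h) /\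
      angle_map al be (z + h) = angle_map al be z * (1 + q h) by near: h.
by split => //; exact: Im_angle_map_gt0.
Unshelve. all: by end_near. Qed.

Lemma powR_lt_near0 (p e x : R) : 0 < p -> 0 < e -> 0 <= x -> x < e `^ p^-1 ->
  x `^ p < e.
Proof.
move=> p0 e0 x0 xe.
have -> : e = (e `^ p^-1) `^ p by rewrite -powRrM mulVf ?powRr1 ?gt_eqF// ltW.
by apply: gt0_ltr_powR => //; rewrite nnegrE ?powR_ge0.
Qed.

(** At the vertex |z'| = |z|^p tends to 0. Any other boundary point has no argument in ]al, be[, so
    nearby points of the angle have arguments close to [al] or [be], where sin (p (th - al)) is
    small. *)
Lemma Im_angle_map_boundary al be zeta e : al < be <= al + 2 * pi -> 0 < e ->
  boundary (angle al be) zeta ->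
  \forall w \near zeta, angle al be w -> complex.Im (angle_map al be w) < e.
Proof.
move=> ab e0 [_ bz].
have {}bz : ~ angle al be zeta.
  by move=> H; apply: bz; move: H; rewrite [X in X -> _](_ : _ = (angle al be)° zeta)//;
    congr (_ _); rewrite (interior_id _).1//; exact: open_angle.
have [albe ab2] := andP ab; have p0 := pow_gt0 albe; set p := pow al be in p0.
have [->|z0] := eqVneq zeta 0.
  apply/nbhs0_normcP; exists (e `^ p^-1); first exact: powR_gt0.
  move=> w we wab.
  apply: (le_lt_trans (ler_norm _)); apply: (le_lt_trans (Im_le_normc _)).
  by rewrite normc_angle_map//; apply: powR_lt_near0; rewrite ?normc_ge0.
have [s zs] := is_arg_exists zeta.
pose M := (normc zeta + 1) `^ p.
have M0 : 0 < M by rewrite powR_gt0// ltr_wpDl ?normc_ge0.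
pose eta := e / (M * p).
have eta0 : 0 < eta by rewrite divr_gt0// mulr_gt0.
have N1 := near_is_arg z0 zs; have N2 := near_Im_clog1 z0 eta0.
apply: near_shift; near=> h => wab.
have [_ zh0 zh] : [/\ zeta + h = zeta * cexp (clog1 (h / zeta)),
    zeta + h != 0 & is_arg (zeta + h) (s + complex.Im (clog1 (h / zeta)))] by near: h.
have : `|complex.Im (clog1 (h / zeta))| < eta by near: h.
set l := complex.Im _ in zh *; rewrite ltr_norml => /andP[l1 l2].
have h1 : normc h < 1 by near: h; exact: near0_normc.
have [_ [th thab wth]] := wab.
rewrite (Im_angle_map ab zh0 thab wth) -/p.
(* This selects the argument s' of zeta that differs from the argument th of zeta + h by the small
   quantity l. *)
have [k /andP[k1 k2]] := shift_window (s + l) th.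
have thE : th = s + 2 * pi * k%:~R + l.
  rewrite addrAC; apply: (is_arg_uniq zh0 _ wth (is_arg_shift k zh)).
  by rewrite ltr_norml; apply/andP; split; lra.
set s' := s + _ in thE.
have zs' : is_arg zeta s' by exact: is_arg_shift.
have [als sbe] := andP thab.
have sin_small : sin (p * (th - al)) < p * eta.
  have [s'al|als'] := leP s' al.
    apply: (@le_lt_trans _ _ (p * (th - al))); last by rewrite ltr_pM2l//; lra.
    by apply: sin_le; apply: mulr_ge0; apply: ltW; rewrite ?subr_gt0.
  have [bes'|s'be] := leP be s'; last first.
    by exfalso; apply: bz; split => //; exists s'; rewrite ?als'.
  (* p (be - al) = pi, so the estimate near [al] is reflected to the side [be]. *)
  have -> : p * (th - al) = - (p * (be - th)) + pi.
    by rewrite /p; field; rewrite subr_eq0 gt_eqF.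
  rewrite sinDpi sinN opprK.
  apply: (@le_lt_trans _ _ (p * (be - th))); last by rewrite ltr_pM2l//; lra.
  by apply: sin_le; apply: mulr_ge0; apply: ltW; rewrite ?subr_gt0.
have wM : normc (zeta + h) `^ p <= M.
  apply: ge0_ler_powR; rewrite ?nnegrE ?normc_ge0 ?addr_ge0 ?normc_ge0 ?(ltW p0)//.
  by apply: (le_trans (le_normcD _ _)); rewrite lerD2l ltW.
have eE : e = M * (p * eta) by rewrite /eta; field; rewrite !gt_eqF.
have pe0 : 0 < p * eta by rewrite mulr_gt0.
apply: (@lt_le_trans _ _ (normc (zeta + h) `^ p * (p * eta))).
  by rewrite ltr_pM2l// powR_gt0// normc_gt0.
by rewrite [leRHS]eE ler_pM2r.
Unshelve. all: by end_near. Qed.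

(* Since [t] exceeds r^p strictly, the half-plane measure tends to 1 at all the
   boundary points of modulus at most [r]. *)
Lemma harmonic_measure_le_angle_measure al be r t z B :
  al < be <= al + 2 * pi -> 0 < r -> r `^ pow al be < t ->
  B `<=` closed_disc r -> angle al be z ->
  (harmonic_measure (angle al be) z B <= (angle_measure al be t z)%:E)%E.
Proof.
move=> ab r0 rt Br zab; have [albe _] := andP ab; have p0 := pow_gt0 albe.
set p := pow al be in rt p0.
have t0 : 0 < t by apply: le_lt_trans rt; exact: powR_ge0.
apply: ge_ereal_sup => _ [u uP <-].
apply: (@perron_family_le R (angle al be) \1_B (angle_measure al be t) u (@open_angle R al be) _ _ _ uP z zab).
- by move=> w wab; exact: harmonic_jet_angle_measure.
- move=> zeta bz e e0.
  rewrite indicE; case: (boolP (zeta \in B)) => [/set_mem/Br|_]; last first.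
    near=> w => _; apply: (@lt_le_trans _ _ 0); first by rewrite sub0r oppr_lt0.
    exact: half_plane_measure_ge0.
  rewrite closed_discE /= => zr.
  (* T^p = t, hence T > r. Points within r1 - r of zeta have modulus at most the midpoint r1, and
     there |z'| <= r1^p < t. *)
  pose T := t `^ p^-1; pose r1 := (r + T) / 2.
  have Tt : T `^ p = t by rewrite /T -powRrM mulVf ?powRr1 ?gt_eqF// ltW.
  have rT : r < T.
    rewrite ltNge; apply/negP => Tr; have : T `^ p <= r `^ p.
      by apply: ge0_ler_powR; rewrite ?nnegrE ?powR_ge0 ?(ltW p0) ?(ltW r0).
    by rewrite Tt leNgt rt.
  have r1p : r1 `^ p < t.
    rewrite -Tt; apply: gt0_ltr_powR => //; rewrite ?nnegrE ?powR_ge0// /r1; lra.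
  have c0 : 0 < t ^+ 2 - (r1 `^ p) ^+ 2.
    by rewrite subr_gt0 ltr_sqr ?nnegrE ?powR_ge0// ltW.
  set c := t ^+ 2 - _ in c0.
  have pi0 := pi_gt0 R.
  (* The bound on Im z' that makes 2 t Im z' / (pi c) smaller than e, where c bounds t^2 - |z'|^2
     from below. *)
  have d0 : 0 < e * c * pi / (2 * t) by rewrite divr_gt0 ?mulr_gt0.
  have N1 := Im_angle_map_boundary ab d0 bz.
  near=> w => wab.
  have I0 := Im_angle_map_gt0 ab wab.
  have /(_ wab) Id : angle al be w ->
    complex.Im (angle_map al be w) < e * c * pi / (2 * t) by near: w.
  have wr1 : normc w <= r1.
    apply: ltW; have wd : normc (w - zeta) < r1 - r.
      near: w; apply/nbhs_normcP; exists (r1 - r) => //; rewrite /r1; lra.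
    have := le_normcD (w - zeta) zeta; rewrite subrK; lra.
  have Zr1 : normc (angle_map al be w) <= r1 `^ p.
    rewrite normc_angle_map//; apply: ge0_ler_powR => //.
    + exact: ltW.
    + by rewrite nnegrE normc_ge0.
    + by rewrite nnegrE /r1; lra.
  have Zt := le_lt_trans Zr1 r1p.
  apply: lt_le_trans (half_plane_measure_ge t0 Zt I0).
  rewrite ltrD2l ltrN2.
  have cZ : c <= t ^+ 2 - normc (angle_map al be w) ^+ 2.
    by rewrite lerD2l lerN2 ler_sqr ?nnegrE ?powR_ge0 ?normc_ge0.
  apply: (@le_lt_trans _ _ (2 / pi * t * complex.Im (angle_map al be w) / c)).
    apply: ler_wpM2l; first by rewrite !mulr_ge0 ?invr_ge0// ltW.
    by rewrite lef_pV2 ?posrE// (lt_le_trans c0).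
  rewrite ltr_pdivrMr// -ltr_pdivlMl; last by rewrite mulr_gt0// divr_gt0.
  by apply: (lt_le_trans Id); rewrite le_eqVlt; apply/orP; left; apply/eqP; rewrite !invfM invrK; ring.
- by move=> w _; exact: half_plane_measure_ge0.
Unshelve. all: by end_near. Qed.

Lemma harmonic_measure_angle_le1 al be r z B :
  al < be <= al + 2 * pi -> 0 < r -> B `<=` closed_disc r -> angle al be z ->
  (harmonic_measure (angle al be) z B <= 1)%E.
Proof.
move=> ab r0 Br zab.
have := @harmonic_measure_le_angle_measure al be r (r `^ pow al be + 1) z B ab r0 _ Br zab.
rewrite ltrDl ltr01 => /(_ isT)/le_trans; apply.
by rewrite lee_fin; exact: half_plane_measure_le1.
Qed.

Lemma Im_inv w : complex.Im w^-1 = - (complex.Im w / normc w ^+ 2).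
Proof. by rewrite normc_sqr; case: w. Qed.

Lemma harmonic_measure_angle_le al be r a z B :
  al < be <= al + 2 * pi -> 0 < r -> B `<=` closed_disc r -> angle al be z ->
  a < 1 -> r <= a * normc z ->
  (harmonic_measure (angle al be) z B <=
   (2 / (pi * (1 - Num.sqrt a) ^+ 2) *
    (r `^ pow al be * - complex.Im (angle_map al be z)^-1))%:E)%E.
Proof.
move=> ab r0 Br zab a1 raz; have [albe _] := andP ab; have p0 := pow_gt0 albe.
have p2 := pow_ge_half ab.
have zn0 : 0 < normc z by rewrite normc_gt0; case: zab.
have a0 : 0 < a by rewrite -(pmulr_lgt0 _ zn0); exact: lt_le_trans raz.
have I0 := Im_angle_map_gt0 ab zab.
have ZN := normc_angle_map ab zab.
rewrite Im_inv opprK.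
set p := pow al be in p0 p2 ZN *; set I := complex.Im _ in I0 *.
set N := normc (angle_map al be z) in ZN *.
set t := r `^ p; set q := Num.sqrt a.
have N0 : 0 < N by rewrite ZN powR_gt0.
have t0 : 0 < t by rewrite powR_gt0.
have q0 : 0 <= q by exact: sqrtr_ge0.
have q1 : q < 1 by rewrite -(@sqrtr1 R) ltr_sqrt.
have tqN : t <= q * N.
  apply: (@le_trans _ _ ((a * normc z) `^ p)).
    apply: ge0_ler_powR => //; [exact: ltW|by rewrite nnegrE ltW|].
    by rewrite nnegrE mulr_ge0// ltW.
  rewrite powRM ?(ltW a0) ?normc_ge0// -ZN ler_pM2r//.
  apply: (@le_trans _ _ (a `^ 2^-1)); last by rewrite powR12_sqrt// ltW.
  by apply: ger_powR; rewrite ?a0 ?(ltW a1).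
have tN : t < N by apply: (le_lt_trans tqN); rewrite gtr_pMl.
pose phi s := 2 / pi * s * I / (N - s) ^+ 2.
have pi0 := pi_gt0 R.
apply: (@le_trans _ _ (phi t)%:E); last first.
  rewrite lee_fin /phi.
  have -> : 2 / (pi * (1 - q) ^+ 2) * (t * (I / N ^+ 2)) =
    2 / pi * t * I / ((1 - q) * N) ^+ 2.
    have := gt_eqF pi0; have := gt_eqF N0.
    have : (1 - q == 0) = false by rewrite gt_eqF// subr_gt0.
    generalize (pi : R) (1 - q) N => x y v y0 v0 x0; field.
    by rewrite x0 y0 v0.
  have d0 : 0 < (1 - q) * N by rewrite mulr_gt0// subr_gt0.
  have d1 : (1 - q) * N <= N - t by lra.
  apply: ler_wpM2l; first by rewrite !mulr_ge0 ?invr_ge0// ltW.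
  by rewrite lef_pV2 ?posrE ?exprn_gt0 ?subr_gt0// ler_sqr ?nnegrE ?(ltW d0)// subr_ge0 ltW.
(* The comparison holds for s > t = r^p only; continuity of phi at t lets s decrease to t. *)
rewrite leNgt; apply/negP => /ereal_lt_fin_between[c [phic ch]].
rewrite lte_fin in phic.
have cphi : {for t, continuous phi}.
  have cN : {for t, continuous (fun s : R => N - s)}.
    by apply: cvgB; [exact: cvg_cst|exact: cvg_id].
  apply: cvgM; first by apply: cvgM; [apply: cvgM; [exact: cvg_cst|exact: cvg_id]|exact: cvg_cst].
  apply: cvgV; last exact: (cvgM cN cN).
  by rewrite gt_eqF// exprn_gt0// subr_gt0.
have : \forall s \near t^'+, False; last by move=> /filter_ex[].
near=> s.
have ts : t < s by near: s; exact: nbhs_right_gt.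
have sN : s < N by near: s; exact: nbhs_right_lt.
have phis : phi s < c.
  near: s; apply: (cvgr_lt (phi t)) => //.
  exact: cvg_at_right_filter.
have := harmonic_measure_le_angle_measure ab r0 ts Br zab.
move=> /(lt_le_trans ch); rewrite lte_fin ltNge => /negP; apply; apply: ltW.
apply: le_lt_trans phis; apply: half_plane_measure_le => //.
by rewrite (lt_trans t0).
Unshelve. all: by end_near. Qed.

(** The constant 0 belongs to the lower Perron class of an indicator. *)
Lemma harmonic_measure_ge0 (D : set R[i]) z B :
  (0 <= harmonic_measure D z B)%E.
Proof.
apply: ereal_sup_ubound; exists (cst 0%E) => //.
have esup0 (F : set_system R[i]) : F setT -> (limf_esup (cst 0%E : R[i] -> \bar R) F <= 0)%E.
  move=> FT; apply: ge_ereal_inf; exists (ereal_sup ((cst 0%E : R[i] -> \bar R) @` setT)).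
    by exists setT.
  by apply: ge_ereal_sup => _ [w _ <-].
split.
- split.
  + by move=> w _; rewrite ltry.
  + by move=> w x _ x0; near=> v; exact: x0.
  + by move=> w _; near=> rho; rewrite /circle_mean integral0 mule0.
- move=> zeta _; apply: (@le_trans _ _ 0%E); first by apply: esup0; near=> w.
  by rewrite lee_fin indicE; case: (_ \in _).
- by apply: esup0; exists 0.
Unshelve. all: by end_near. Qed.

Lemma le_harmonic_measure (D : set R[i]) z A B : A `<=` B ->
  (harmonic_measure D z A <= harmonic_measure D z B)%E.
Proof.
move=> AB; apply: ereal_sup_le => _ [u [u1 u2 u3] <-]; exists u => //; split => //.
move=> zeta bz; apply: (le_trans (u2 _ bz)); rewrite lee_fin !indicE.
by case: (boolP (zeta \in A)) => // /set_mem/AB/mem_set ->.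
Qed.

End AngleMeasure.

(** * Variations of a charge *)

Section Variations.
Context {R : realType}.
Local Open Scope ereal_scope.
Implicit Types (nu : set R[i] -> \bar R) (A B : set R[i]).

(** With 0 in both sets the suprema are nonnegative, so oo - oo cannot occur and each summand can be
    moved across in turn. *)
Lemma ereal_supD_le (X Y : set (\bar R)) (M : \bar R) : X 0 -> Y 0 ->
  (forall x y, X x -> Y y -> x + y <= M) -> ereal_sup X + ereal_sup Y <= M.
Proof.
move=> X0 Y0 XYM.
have M0 : 0 <= M by have := XYM _ _ X0 Y0; rewrite adde0.
case: M XYM M0 => [m| |//] XYM m0; last by rewrite leey.
have Xm : ereal_sup X <= m%:E.
  by apply: ge_ereal_sup => x Xx; have := XYM _ _ Xx Y0; rewrite adde0.
have X00 : 0 <= ereal_sup X by exact: ereal_sup_ubound.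
have Xfin : ereal_sup X \is a fin_num.
  by rewrite ge0_fin_numE// (le_lt_trans Xm)// ltry.
rewrite addeC -leeBrDr//; apply: ge_ereal_sup => y Yy; rewrite leeBrDr//.
have ym : y <= m%:E by have := XYM _ _ X0 Yy; rewrite add0e.
case: y Yy ym => [y| |] Yy ym; [|by []|by rewrite addNye leNye].
rewrite addeC -leeBrDr//; apply: ge_ereal_sup => x Xx; rewrite leeBrDr//.
exact: XYM.
Qed.

Lemma le_upper_variation nu A B : A `<=` B ->
  upper_variation nu A <= upper_variation nu B.
Proof.
by move=> AB; apply: ereal_sup_le => _ [C [mC CA] <-]; exists C => //; split => //; exact: subset_trans AB.
Qed.

(** The name carries the proof of [is_charge nu], so that a measure structure can be attached to
    it. *)
Definition upper_variation_measure nu of is_charge nu : set R[i] -> \bar R :=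
  upper_variation nu.

Section FixedCharge.
Variables (nu : set R[i] -> \bar R) (nuC : is_charge nu).

Let nu0 : nu set0 = 0. Proof. by case: nuC. Qed.

Lemma is_charge_setU A B : measurable A -> measurable B -> A `&` B = set0 ->
  nu (A `|` B) = nu A + nu B.
Proof.
move=> mA mB AB; case: nuC => _ _ sa _.
apply: (semi_additiveW nu0 (semi_sigma_additive_is_additive nu0 sa)) => //.
exact: measurableU.
Qed.

Lemma upper_variation_ge0 A : 0 <= upper_variation nu A.
Proof. by apply: ereal_sup_ubound; exists set0 => //; split => //; exact: sub0set. Qed.

Lemma upper_variation0 : upper_variation nu set0 = 0.
Proof.
apply/eqP; rewrite eq_le upper_variation_ge0 andbT.
apply: ge_ereal_sup => _ [B [mB B0] <-].
by have -> : B = set0 by [rewrite -subset0]; rewrite nu0.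
Qed.

Lemma upper_variation_superadditive A B : measurable A -> measurable B ->
  A `&` B = set0 ->
  upper_variation nu A + upper_variation nu B <= upper_variation nu (A `|` B).
Proof.
move=> mA mB AB; apply: ereal_supD_le; [by exists set0 => //; split => //; exact: sub0set|by exists set0 => //; split => //; exact: sub0set|].
move=> _ _ [C [mC CA] <-] [D [mD DB] <-].
rewrite -is_charge_setU//.
  by apply: ereal_sup_ubound; exists (C `|` D) => //; split; [exact: measurableU|exact: setUSS].
by apply/seteqP; split => // x [/CA Ax /DB Bx]; rewrite -AB.
Qed.

(** Superadditivity and monotonicity bound the partial sums by the variation of the union;
    conversely, a competitor B is cut along the sets F n and nu is summed over the pieces. *)
Lemma upper_variation_sigma_additive : semi_sigma_additive (upper_variation nu).
Proof.
move=> F mF tF mUF.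
have cvg_nn : cvg ((\sum_(0 <= i < n) upper_variation nu (F i)) @[n --> \oo]).
  by apply: is_cvg_nneseries => n _ _; exact: upper_variation_ge0.
suff <- : limn (fun n => \sum_(0 <= i < n) upper_variation nu (F i)) =
    upper_variation nu (\bigcup_n F n) by exact: cvg_nn.
apply/eqP; rewrite eq_le; apply/andP; split.
  apply: lime_le => //; near=> n.
  apply: (@le_trans _ _ (upper_variation nu (\big[setU/set0]_(i < n) F i))); last first.
    by apply: le_upper_variation; exact: bigsetU_bigcup.
  elim: (n) => [|m IH]; first by rewrite big_nil big_ord0 upper_variation0.
  rewrite big_nat_recr//= big_ord_recr/=.
  apply: (le_trans (leeD2r _ IH)).
  apply: upper_variation_superadditive => //; first exact: bigsetU_measurable.
  apply/seteqP; split=> // x []; rewrite -bigcup_mkord => -[k /= km Fk Fm].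
  have kmE := tF k m I I (ex_intro _ x (conj Fk Fm)).
  by rewrite kmE ltnn in km.
apply: ge_ereal_sup => _ [B [mB BF] <-].
have BE : B = \bigcup_n (B `&` F n) by rewrite -setI_bigcupr; apply/esym/setIidPl.
have mBF i : measurable (B `&` F i) by exact: measurableI.
have tBF : trivIset [set: nat] (fun n => B `&` F n) by exact: trivIset_setIl.
have /(_ _ mBF tBF) : semi_sigma_additive nu by case: nuC.
rewrite -BE => /(_ mB) cB; rewrite -(cvg_lim _ cB)//.
apply: lee_lim => //; first by apply/cvg_ex; exists (nu B).
near=> n; apply: lee_sum => i _.
by apply: ereal_sup_ubound; exists (B `&` F i) => //; split => //; exact: subIsetr.
Unshelve. all: by end_near. Qed.

HB.instance Definition _ := isMeasure.Build _ R[i] R (upper_variation_measure nuC)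
  upper_variation0 upper_variation_ge0 upper_variation_sigma_additive.

End FixedCharge.

Lemma is_chargeN nu : is_charge nu -> is_charge (\- nu).
Proof.
move=> [nu0 nuD nus nuK]; split.
- by rewrite nu0 oppe0.
- by move=> A B mA mB AB; rewrite adde_defNN; exact: nuD.
- move=> F mF tF mUF.
  rewrite (_ : (fun n => _) = (fun n => - \sum_(0 <= i < n) nu (F i))).
    by apply: cvgeN; exact: nus.
  apply/funext => n; rewrite -sumeN// => i j _ _.
  have [->|ij] := eqVneq i j; first by case: (nu (F j)).
  by apply: nuD => //; move/trivIsetP: tF; apply.
- by move=> K cK; rewrite fin_numN; exact: nuK.
Qed.

End Variations.

(** * Finiteness of the variation on sets of finite charge *)

Section FiniteVariation.
Context {R : realType}.
Local Open Scope ereal_scope.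
Variables (nu : set R[i] -> \bar R) (nuC : is_charge nu).
Variables (K : set R[i]) (mK : measurable K) (nuK : nu K \is a fin_num).

(** The Hahn decomposition is applied to this restriction, which is finite-valued: a finite nu K is
    a sum of the values on the parts of K inside and outside A, so both are finite. *)
Definition charge_restr (A : set R[i]) : \bar R := nu (A `&` K).

Let restr0 : charge_restr set0 = 0.
Proof. by rewrite /charge_restr set0I; case: nuC. Qed.

Let restr_fin (A : set R[i]) : measurable A -> charge_restr A \is a fin_num.
Proof.
move=> mA; have := nuK.
rewrite -{1}(setUIDK K A) (is_charge_setU nuC) ?fin_numD.
- by rewrite setIC => /andP[].
- exact: measurableI.
- exact: measurableD.
- by apply/seteqP; split => // x [[_ ?] [_]].
Qed.

Let restr_sigma_additive : semi_sigma_additive charge_restr.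
Proof.
move=> F mF tF mUF; rewrite /charge_restr setI_bigcupl.
have [_ _ nus _] := nuC; apply: nus.
- by move=> i; exact: measurableI.
- exact: trivIset_setIr.
- by apply: bigcup_measurable => i _; exact: measurableI.
Qed.

HB.instance Definition _ := isCharge.Build _ R[i] R charge_restr
  restr0 restr_fin restr_sigma_additive.

(** The value on the positive Hahn set P bounds nu B for all B in K: dropping the part in the
    negative set and enlarging the rest to P can only increase it. *)
Lemma upper_variation_lty : upper_variation nu K < +oo.
Proof.
have [P [N [[mP P0] [mN N0] PN PN0]]] := Hahn_decomposition charge_restr.
apply: (@le_lt_trans _ _ (charge_restr P)); last by rewrite ltey_eq restr_fin.
apply: ge_ereal_sup => _ [B [mB BK] <-].
have mBP : measurable (B `&` P) by exact: measurableI.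
have mBN : measurable (B `&` N) by exact: measurableI.
have -> : nu B = charge_restr (B `&` P) + charge_restr (B `&` N).
  rewrite -chargeU//; last by rewrite setIACA PN0 setI0.
  have BKE : B `&` K = B by apply/setIidPl.
  by rewrite -setIUr PN setIT /= /charge_restr BKE.
apply: (@le_trans _ _ (charge_restr (B `&` P))).
  by rewrite -[leRHS]adde0 leeD2l// N0//; exact: subIsetr.
rewrite -[in leRHS](setUIDK P B) chargeU.
- rewrite setIC -[leLHS]adde0 leeD2l//; apply: P0; [exact: measurableD|exact: subDsetl].
- exact: measurableI.
- exact: measurableD.
- by apply/seteqP; split => // x [[_ ?] [_]].
Qed.

End FiniteVariation.

(** * The estimate *)

Section AngleDensity.
Context {R : realType}.
Implicit Types (z : R[i]) (al be r : R).

Lemma angle_map_continuous al be z : al < be <= al + 2 * pi -> angle al be z ->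
  {for z, continuous (angle_map al be : R[i] -> R[i])}.
Proof.
move=> ab zab; have [q jq qE] := angle_map_jet ab zab.
move=> A /nbhs_normcP[d d0 dA].
set N := normc (angle_map al be z).
have N0 : 0 <= N := normc_ge0 _.
have dN : 0 < d / (N + 1) by rewrite divr_gt0// ltr_wpDl.
have /cvg0_normcP/(_ _ dN) qd := jet2_cvg0 jq.
apply: near_shift; near=> h; apply: dA.
have [_ ->] : angle al be (z + h) /\
  angle_map al be (z + h) = angle_map al be z * (1 + q h) by near: h.
have -> : angle_map al be z * (1 + q h) - angle_map al be z = angle_map al be z * q h by ring.
rewrite normcM -/N.
have qh : normc (q h) < d / (N + 1) by near: h.
have q0 := normc_ge0 (q h).
rewrite ltr_pdivlMr ?ltr_wpDl// in qh; nra.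
Unshelve. all: by end_near. Qed.

Lemma continuous_divr_sqr (T : topologicalType) (f g : T -> R) (x : T) :
  {for x, continuous f} -> {for x, continuous g} -> g x != 0 ->
  {for x, continuous (fun y => f y / g y ^+ 2)}.
Proof.
move=> cf cg gx; apply: cvgM => //; apply: cvgV; last exact: (cvgM cg cg).
by rewrite expf_eq0.
Qed.

Lemma measurable_angle al be : measurable (angle al be : set R[i]).
Proof. by apply: measurable_openC; exact: open_angle. Qed.

Lemma measurable_angle_density al be : al < be <= al + 2 * pi ->
  measurable_fun (angle al be)
    (fun z : R[i] => - complex.Im (angle_map al be z)^-1).
Proof.
move=> ab; apply: measurable_fun_open_continuous; first exact: open_angle.
move=> z zab; have cZ := angle_map_continuous ab zab.
rewrite (_ : (fun _ => _) = (fun z => complex.Im (angle_map al be z) /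
   normc (angle_map al be z) ^+ 2)); last by apply/funext => w; rewrite Im_inv opprK.
apply: continuous_divr_sqr.
- by apply: (continuous_comp cZ); exact: Im_continuous.
- by apply: (continuous_comp cZ); exact: normc_continuous.
- have := Im_angle_map_gt0 ab zab; apply: contraTneq => /eq0_normc ->.
  by rewrite ltxx.
Qed.

Lemma angle_density_ge0 al be z : al < be <= al + 2 * pi -> angle al be z ->
  0 <= - complex.Im (angle_map al be z)^-1.
Proof.
move=> ab zab; rewrite Im_inv opprK divr_ge0 ?exprn_ge0 ?normc_ge0//.
exact: ltW (Im_angle_map_gt0 ab zab).
Qed.

End AngleDensity.

Section RaysHarmonicMeasure.
Context {R : realType}.
Local Open Scope ereal_scope.
Implicit Types (S B : set R[i]) (z : R[i]) (r a : R).

Lemma rays_harmonic_measure_ge0 S z B : 0 <= rays_harmonic_measure S z B.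
Proof.
rewrite /rays_harmonic_measure; case: ifPn => _; last exact: harmonic_measure_ge0.
by rewrite diracE lee_fin.
Qed.

Lemma le_rays_harmonic_measure S z A B : A `<=` B ->
  rays_harmonic_measure S z A <= rays_harmonic_measure S z B.
Proof.
move=> AB; rewrite /rays_harmonic_measure; case: ifPn => _.
  by rewrite !diracE lee_fin; case: (boolP (z \in A)) => // /set_mem/AB/mem_set ->.
exact: le_harmonic_measure.
Qed.

Lemma complementary_angleP S z : system_of_rays S -> S !=set0 -> closed S -> ~ S z ->
  exists2 ab, complementary_angles S ab & angle ab.1 ab.2 z /\
    angle ab.1 ab.2 = connected_component (~` S) z.
Proof.
move=> rS S0 cS Sz; have [al [be [ab E]]] := angle_complementary rS S0 cS Sz.
by exists (al, be) => //=; split => //; rewrite E; exact: connected_component_refl.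
Qed.

Lemma rays_harmonic_measure_le1 S z B r : system_of_rays S -> S !=set0 ->
  closed S -> (0 < r)%R -> B `<=` closed_disc r -> rays_harmonic_measure S z B <= 1.
Proof.
move=> rS S0 cS r0 Br; rewrite /rays_harmonic_measure; case: ifPn => [_|].
  by rewrite diracE lee_fin; case: (_ \in _).
move=> /negP Sz; have {}Sz : ~ S z by move=> /mem_set.
have [ab [_ ab2 _] [zab <-]] := complementary_angleP rS S0 cS Sz.
exact: harmonic_measure_angle_le1 ab2 r0 Br zab.
Qed.

(** The first alternative is for z in S, where no angle is at hand and the Dirac measure misses the
    disc because r < |z|. *)
Lemma rays_harmonic_measure_le S z B r a : system_of_rays S -> S !=set0 ->
  closed S -> (0 < r)%R -> B `<=` closed_disc r -> (a < 1)%R ->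
  (r <= a * normc z)%R -> (r < normc z)%R ->
  rays_harmonic_measure S z B = 0 \/
  exists2 ab, complementary_angles S ab & angle ab.1 ab.2 z /\
    rays_harmonic_measure S z B <= (2 / (pi * (1 - Num.sqrt a) ^+ 2))%:E *
      ((r `^ (pi / (ab.2 - ab.1)))%:E *
       (- complex.Im (angle_map ab.1 ab.2 z)^-1)%:E).
Proof.
move=> rS S0 cS r0 Br a1 raz rz; have [Sz|Sz] := pselect (S z).
  left; rewrite /rays_harmonic_measure mem_set// diracE.
  case: (boolP (z \in B)) => // /set_mem/Br; rewrite closed_discE /=.
  by rewrite leNgt rz.
right; have [ab Cab [zab E]] := complementary_angleP rS S0 cS Sz.
exists ab => //; split => //.
rewrite /rays_harmonic_measure memNset// -E -!EFinM.
by have [_ ab2 _] := Cab; exact: harmonic_measure_angle_le.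
Qed.

End RaysHarmonicMeasure.

Section Estimate.
Context {R : realType}.
Local Open Scope ereal_scope.

(** Indexing the angles by a set of natural numbers turns the sum over them into a series, which can
    be exchanged with the integral. *)
Lemma countable_set_bij (T : pointedType) (D : set T) : countable D ->
  exists (B : set nat) (e : nat -> T), set_bij B D e.
Proof.
move=> /countable_bijP[B]; rewrite card_eq_sym => /card_set_bijP[e eP].
by exists B, e.
Qed.

Variables (nu : set R[i] -> \bar R) (nuC : is_charge nu).

Let mu : {measure set R[i] -> \bar R} :=
  measure_add (upper_variation_measure nuC) (upper_variation_measure (is_chargeN nuC)).

Lemma charge_absE : charge_abs nu = mu.
Proof. by apply/funext => A; apply/esym; exact: measure_addE. Qed.

Variables (S : set R[i]) (r rho a : R).
Hypotheses (rS : system_of_rays S) (S0 : S !=set0) (cS : closed S).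
Hypotheses (r0 : (0 < r)%R) (a1 : (a < 1)%R) (r_rho : (r <= a * rho)%R)
  (rho0 : (0 < rho)%R).

(** The right-hand side is the integral against |nu| of one measurable function [Phi], the indicator
    of the disc of radius rho plus the series of weighted densities of the angles. [Phi] dominates
    the harmonic measure pointwise, so the integrals against nu^+ and nu^- are compared one by
    one. *)
Lemma integral_rays_harmonic_measure_le :
  \int[upper_variation nu]_z rays_harmonic_measure S z (closed_disc r) +
  \int[lower_variation nu]_z rays_harmonic_measure S z (closed_disc r) <=
  radial (charge_abs nu) rho +
  (2 / (pi * (1 - Num.sqrt a) ^+ 2))%:E * C_plus S nu r rho.
Proof.
have [B [e eP]] := countable_set_bij (countable_complementary_angles S).
have [eB einj esurj] := eP.
set K : R := (2 / _)%R.
have K0 : (0 <= K)%R.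
  by rewrite divr_ge0// mulr_ge0 ?pi_ge0// sqr_ge0.
pose A i : set R[i] := angle (e i).1 (e i).2 `\` open_disc rho.
have mA i : measurable (A i).
  by apply: measurableD; [exact: measurable_angle|apply: measurable_openC; exact: open_open_disc].
pose h i z : \bar R := (- complex.Im (angle_map (e i).1 (e i).2 z)^-1)%:E.
pose c i : R := (r `^ (pi / ((e i).2 - (e i).1)))%R.
have abP i : B i -> ((e i).1 < (e i).2 <= (e i).1 + 2 * pi)%R.
  by move=> /eB; case.
have h0 i z : B i -> A i z -> 0 <= h i z.
  by move=> /abP ab [zab _]; rewrite lee_fin; exact: angle_density_ge0.
have mh i : B i -> measurable_fun (A i) (h i).
  move=> /abP ab; apply/measurable_EFinP.
  apply: (measurable_funS (measurable_angle _ _) (@subDsetl _ _ _)).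
  exact: measurable_angle_density.
(* Indices outside B enumerate no angle and contribute 0. *)
pose G i z : \bar R := if i \in B then K%:E * ((c i)%:E * ((h i) \_ (A i)) z) else 0.
have hA0 i z : B i -> 0 <= ((h i) \_ (A i)) z.
  by move=> Bi; rewrite /patch; case: ifPn => // /set_mem; exact: h0.
have G0 i z : 0 <= G i z.
  rewrite /G; case: ifPn => // /set_mem Bi; rewrite mule_ge0 ?lee_fin//.
  by rewrite mule_ge0 ?hA0// lee_fin powR_ge0.
have mhA i : B i -> measurable_fun setT ((h i) \_ (A i)).
  move=> Bi; have H := measurable_restrictT (h i) (mA i); exact: H.1 (mh _ Bi).
have GB i : B i -> G i = (fun z => K%:E * ((c i)%:E * ((h i) \_ (A i)) z)).
  by move=> Bi; apply/funext => z; rewrite /G mem_set.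
have GN i : i \notin B -> G i = cst 0.
  by move=> Bi; apply/funext => z; rewrite /G (negbTE Bi).
have mG i : measurable_fun setT (G i).
  have [/set_mem Bi|Bi] := boolP (i \in B); last by rewrite GN//; exact: measurable_cst.
  by rewrite GB//; apply: measurable_funeM; apply: measurable_funeM; exact: mhA.
have mD : measurable (closed_disc rho : set R[i]).
  by apply: measurable_closedC; exact: closed_closed_disc.
pose Phi z : \bar R := (\1_(closed_disc rho) z)%:E + \sum_(0 <= i <oo) G i z.
have m1D : measurable_fun setT (fun z : R[i] => (\1_(closed_disc rho) z)%:E : \bar R).
  by apply/measurable_EFinP; exact: measurable_indic.
have sG0 z : 0 <= \sum_(0 <= i <oo) G i z by apply: nneseries_ge0.
have msG : measurable_fun setT (fun z => \sum_(0 <= i <oo) G i z).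
  by apply: ge0_emeasurable_sum => // i z _ _.
have Phi0 z : 0 <= Phi z by rewrite adde_ge0// lee_fin.
have mPhi : measurable_fun setT Phi by exact: emeasurable_funD.
have rhm_Phi z : rays_harmonic_measure S z (closed_disc r) <= Phi z.
  rewrite /Phi indicE; case: (boolP (z \in closed_disc rho)) => [_|/negP zrho].
    apply: (le_trans (rays_harmonic_measure_le1 z rS S0 cS r0 (@subset_refl _ _))).
    by rewrite leeDl.
  have {}zrho : (rho < normc z)%R.
    by rewrite ltNge; apply/negP => H; apply: zrho; rewrite inE closed_discE.
  have rho_r : (r < rho)%R by apply: (le_lt_trans r_rho); rewrite gtr_pMl.
  have a0 : (0 < a)%R by rewrite -(pmulr_lgt0 _ rho0); exact: lt_le_trans r_rho.
  have raz : (r <= a * normc z)%R.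
    by apply: (le_trans r_rho); rewrite ler_pM2l// ltW.
  rewrite add0e.
  have [->//|[ab Cab [zab le]]] := rays_harmonic_measure_le rS S0 cS r0
    (@subset_refl _ _) a1 raz (lt_trans rho_r zrho).
  have [i Bi iE] := esurj _ Cab.
  apply: (le_trans le); rewrite nneseries_esumT//.
  (* The single term of the angle containing z already dominates. *)
  apply: esum_ge; exists [set i]; first by split; [exact: finite_set1|].
  rewrite fsbig_set1 /G mem_set//.
  have Aiz : A i z.
    by split; [rewrite iE|rewrite open_discE /= => H; have := lt_trans H zrho; rewrite ltxx].
  by rewrite /patch mem_set// /h /c iE.
have -> : C_plus S nu r rho = \sum_(0 <= i <oo) (if i \in B then (c i)%:E * \int[mu]_(z in A i) h i z else 0).
  rewrite nneseries_esumT; last first.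
    move=> i; case: ifPn => // /set_mem Bi; rewrite mule_ge0 ?lee_fin ?powR_ge0//.
    by apply: integral_ge0 => z; exact: h0.
  by rewrite -esum_mkcond /C_plus charge_absE (@reindex_esum R _ _ B (complementary_angles S) e _ eP).
have -> : radial (charge_abs nu) rho +
    K%:E * \sum_(0 <= i <oo) (if i \in B then (c i)%:E * \int[mu]_(z in A i) h i z else 0) =
    \int[mu]_z Phi z.
  rewrite /Phi ge0_integralD//.
  rewrite integral_indic// setIT /radial charge_absE integral_nneseries//.
  congr (_ + _); rewrite -nneseriesZl; last first.
    move=> i _; case: ifPn => // /set_mem Bi; rewrite mule_ge0 ?lee_fin ?powR_ge0//.
    by apply: integral_ge0 => z; exact: h0.
  apply: eq_eseriesr => i _; have [iB|iB] := boolP (i \in B); last first.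
    by rewrite mule0 GN// integral0.
  have Bi := set_mem iB; rewrite GB//.
  rewrite ge0_integralZl//; last 2 first.
  - by apply: measurable_funeM; exact: mhA.
  - by move=> z _; rewrite mule_ge0 ?hA0// lee_fin powR_ge0.
  rewrite ge0_integralZl//.
  - by rewrite -integral_mkcond.
  - exact: mhA.
  - by move=> z _; exact: hA0.
  - by rewrite lee_fin powR_ge0.
rewrite /mu ge0_integral_measure_add//.
apply: leeD.
  apply: (@ge0_le_integral_raw _ _ _ (upper_variation_measure nuC) setT
    (fun z => rays_harmonic_measure S z (closed_disc r)) Phi) => z _.
    exact: rays_harmonic_measure_ge0.
  exact: rhm_Phi.
apply: (@ge0_le_integral_raw _ _ _ (upper_variation_measure (is_chargeN nuC)) setT
  (fun z => rays_harmonic_measure S z (closed_disc r)) Phi) => z _.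
  exact: rays_harmonic_measure_ge0.
exact: rhm_Phi.
Qed.

End Estimate.

Section FiniteBounds.
Context {R : realType}.
Local Open Scope ereal_scope.

Lemma charge_variation_disc_lty (nu : set R[i] -> \bar R) (r : R) :
  is_charge nu -> radial (charge_abs nu) r < +oo.
Proof.
move=> nuC; have mD : measurable (closed_disc r : set R[i]).
  by apply: measurable_closedC; exact: closed_closed_disc.
have H (nu' : set R[i] -> \bar R) : is_charge nu' -> upper_variation nu' (closed_disc r) < +oo.
  move=> C; apply: (upper_variation_lty C mD); case: C => _ _ _; apply.
  exact: compact_closed_disc.
by rewrite /radial /charge_abs lte_add_pinfty//; apply: H => //; exact: is_chargeN.
Qed.

Lemma bounded_set_sub_disc (B : set R[i]) : bounded_set B ->
  exists M : R, forall r, (M <= r)%R -> B `<=` closed_disc r.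
Proof.
move=> [M [/complex_realP[m ->] MP]]; exists (m + 1)%R => r mr z Bz.
have m1 : (m%:C%C < (m + 1)%R%:C%C :> R[i])%R by rewrite ltcR ltrDl ltr01.
have H := MP _ m1 z Bz.
by apply: (le_trans H); rewrite lecR.
Qed.

Lemma sube_le_left (x y : \bar R) : 0 <= y -> x - y <= x.
Proof. by move=> y0; rewrite -[leRHS]sube0; apply: leeB. Qed.

End FiniteBounds.

Unset Implicit Arguments.
Set Strict Implicit.

Theorem mainTheorem2 (R : realType) (nu : set R[i] -> \bar R) (S : set R[i])
    (E : set R) (g : R -> R) (a : R)
    (nu_charge : is_charge nu)
    (S_rays : system_of_rays S) (S_neq0 : S !=set0) (S_closed : closed S)
    (E_gt0 : forall r, E r -> 0 < r)
    (E_unbounded : forall M : R, exists2 r, E r & M < r)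
    (g_gt0 : forall r, E r -> 0 < g r)
    (a_sup : ereal_sup [set (r / g r)%:E | r in E] = a%:E) (a_lt1 : a < 1)
    (C_lty : forall r, E r -> (C_plus S nu r (g r) < +oo)%E) :
  balayage_exists nu S /\
  (forall r, E r ->
    (radial (charge_abs (balayage nu S)) r <=
     radial (charge_abs nu) (g r) +
     (2 / (pi * (1 - Num.sqrt a) ^+ 2))%:E * C_plus S nu r (g r))%E).
Proof.
have a_ge r : E r -> r <= a * g r.
  move=> Er; rewrite -ler_pdivrMr ?g_gt0// -lee_fin -a_sup.
  by apply: ereal_sup_ubound; exists r.
pose I1 B := (\int[upper_variation nu]_z rays_harmonic_measure S z B)%E.
pose I2 B := (\int[lower_variation nu]_z rays_harmonic_measure S z B)%E.
have I1_ge0 B : (0 <= I1 B)%E.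
  apply: (@integral_ge0 _ _ _ (upper_variation_measure nu_charge)) => z _.
  exact: rays_harmonic_measure_ge0.
have I2_ge0 B : (0 <= I2 B)%E.
  apply: (@integral_ge0 _ _ _ (upper_variation_measure (is_chargeN nu_charge))) => z _.
  exact: rays_harmonic_measure_ge0.
have I1_le A B : A `<=` B -> (I1 A <= I1 B)%E.
  move=> AB; apply: (@ge0_le_integral_raw _ _ _ (upper_variation_measure nu_charge)) => z _.
    exact: rays_harmonic_measure_ge0.
  exact: le_rays_harmonic_measure.
have I2_le A B : A `<=` B -> (I2 A <= I2 B)%E.
  move=> AB; apply: (@ge0_le_integral_raw _ _ _ (upper_variation_measure (is_chargeN nu_charge))) => z _.
    exact: rays_harmonic_measure_ge0.
  exact: le_rays_harmonic_measure.
pose Q r := (radial (charge_abs nu) (g r) +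
  (2 / (pi * (1 - Num.sqrt a) ^+ 2))%:E * C_plus S nu r (g r))%E.
have IQ r : E r -> (I1 (closed_disc r) + I2 (closed_disc r) <= Q r)%E.
  move=> Er; exact: (integral_rays_harmonic_measure_le nu_charge S_rays S_neq0
    S_closed (E_gt0 _ Er) a_lt1 (a_ge _ Er) (g_gt0 _ Er)).
have Q_lty r : E r -> (Q r < +oo)%E.
  move=> Er; apply: lte_add_pinfty; first exact: charge_variation_disc_lty.
  apply: lte_mul_pinfty => //; last exact: C_lty.
  by rewrite lee_fin divr_ge0// mulr_ge0 ?pi_ge0// sqr_ge0.
have I1_lty r : E r -> (I1 (closed_disc r) < +oo)%E.
  move=> Er; apply: le_lt_trans (Q_lty _ Er); apply: le_trans (IQ _ Er).
  by rewrite leeDl.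
have I2_lty r : E r -> (I2 (closed_disc r) < +oo)%E.
  move=> Er; apply: le_lt_trans (Q_lty _ Er); apply: le_trans (IQ _ Er).
  by rewrite leeDr.
have I_fin r B : E r -> B `<=` closed_disc r ->
    I1 B \is a fin_num /\ I2 B \is a fin_num.
  move=> Er Br; rewrite !ge0_fin_numE//; split.
    exact: le_lt_trans (I1_le _ _ Br) (I1_lty _ Er).
  exact: le_lt_trans (I2_le _ _ Br) (I2_lty _ Er).
split.
  move=> B mB /bounded_set_sub_disc[M MB].
  (* Some disc with radius in [E] contains B, and both integrals are finite there. *)
  have [r Er Mr] := E_unbounded M.
  have [H1 H2] := I_fin r B Er (MB _ (ltW Mr)).
  by rewrite /balayage /charge_integral -/(I1 B) -/(I2 B) fin_numB H1.
(* For Borel B in the disc the balayage has the value I1 B - I2 B; hence its upper variation is at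
   most I1 of the disc and its lower variation at most I2 of the disc. *)
move=> r Er; apply: le_trans (IQ _ Er); rewrite /radial /charge_abs.
apply: leeD; apply: ge_ereal_sup => _ [B [mB Br] <-].
  apply: le_trans (I1_le _ _ Br).
  by rewrite /balayage /charge_integral -/(I1 B) -/(I2 B); exact: sube_le_left.
apply: le_trans (I2_le _ _ Br).
have [H1 H2] := I_fin r B Er Br.
rewrite /balayage /charge_integral -/(I1 B) -/(I2 B) fin_num_oppeB//.
by rewrite addeC; exact: sube_le_left.
Qed.
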